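(* Let $n\geq 3$. The connected Coxeter-Dynkin diagrams (of finite Coxeter groups generated by $n$ reflections in $\mathbb{R}^n$) that give rise to Platonic solids in $\mathbb{R}^n$ are precisely those of types $A_n$, $B_n$, $C_n$ (for any $n\geq 3$), $F_4$ ($n=4$), $H_3$ ($n=3$) and $H_4$ ($n=4$).
   Context: Finite Coxeter group: a finite reflection group $W$ acting on the real Euclidean space $\mathbb{R}^n$ spanned by linearly independent simple roots $\alpha_1,\dots,\alpha_n$. It is generated by the reflections $r_k x = x-\frac{2\langle \alpha_k,x\rangle}{\langle\alpha_k,\alpha_k\rangle}\alpha_k$, $k=1,\dots,n$. The connected diagrams considered are those of the finite-dimensional simple Lie algebras (whose Weyl groups are the crystallographic finite Coxeter groups) together with those of the non-crystallographic groups $H_2,H_3,H_4$. The diagrams $B_n$ and $C_n$ differ only in the relative lengths of the simple roots and define the same reflection group. Polytope generated by $W$: the convex hull $P$ of the orbit $Wx_0$ of a single nonzero point $x_0\in\mathbb{R}^n$ (the seed point), taken in the closed dominant chamber, i.e. $\langle\alpha_k,x_0\rangle\geq 0$ for all $k$. Faces are those of the convex polytope $P$. Platonic: $P$ is called Platonic if, for each $0\leq d\leq n-1$, all $d$-dimensional faces of $P$ belong to a single orbit of $W$. A Coxeter-Dynkin diagram of a group $W$ gives rise to a Platonic solid in $\mathbb{R}^n$ if some polytope generated by $W$ from a single seed point is Platonic. *)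

(* Defs.v *)
From HB Require Import structures.
From mathcomp Require Import all_boot all_order all_algebra.
From mathcomp Require Import all_classical all_reals all_analysis.

Set Implicit Arguments.
Unset Strict Implicit.
Unset Printing Implicit Defensive.
Import Order.TTheory GRing.Theory Num.Theory.
Local Open Scope classical_set_scope.
Local Open Scope ring_scope.

(** Connected Coxeter-Dynkin diagrams.  Each diagram is given by its family
    and its number n of nodes; the nodes are numbered 0, ..., n-1. *)

Inductive diagram_family := FamA | FamB | FamC | FamD | FamE | FamF | FamG | FamH.

(** Usual ranks.  D starts at 4 because D_3 is A_3 and D_2 is not connected;
    the coincidence B_2 = C_2 is harmless. *)
Definition is_diagram (X : diagram_family) (n : nat) : bool :=
  match X with
  | FamA => (1 <= n)%N
  | FamB | FamC => (2 <= n)%N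
  | FamD => (4 <= n)%N
  | FamE => (6 <= n <= 8)%N
  | FamF => n == 4%N
  | FamG => n == 2%N
  | FamH => (2 <= n <= 4)%N
  end.

(** [bond X n i j], for i < j < n, is the order of r_i r_j: it is 2 when the
    nodes i and j are not linked, and 3, 4, 6, 5 for a single, double, triple
    link and for the link labelled 5 in H_n.
    All families but D and E are chains 0 - 1 - ... - (n-1), the exceptional
    link of B, C and H being the last one and that of F_4 the middle one.  In
    D and E the nodes 0, ..., n-2 form a chain, and n-1 is attached to n-3
    for D_n, to 2 for E_n. *)
Definition bond (X : diagram_family) (n i j : nat) : nat :=
  match X with
  | FamA => if j == i.+1 then 3 else 2
  | FamB | FamC =>
      if j == i.+1 then (if j == n.-1 then 4 else 3) else 2
  | FamD => if (if j == n.-1 then i == (n - 3)%N else j == i.+1) then 3 else 2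
  | FamE => if (if j == n.-1 then i == 2%N else j == i.+1) then 3 else 2
  | FamF => if j == i.+1 then (if i == 1%N then 4 else 3) else 2
  | FamG => if j == i.+1 then 6 else 2
  | FamH => if j == i.+1 then (if j == n.-1 then 5 else 3) else 2
  end%N.

(** Squared length of the i-th simple root, up to a common factor. *)
Definition sqlen (X : diagram_family) (n i : nat) : nat :=
  match X with
  | FamA | FamD | FamE | FamH => 1
  | FamB => if i == n.-1 then 1 else 2
  | FamC => if i == n.-1 then 2 else 1
  | FamF => if (i < 2)%N then 2 else 1
  | FamG => if i == 0%N then 3 else 1
  end%N.

Section Geometry.
Variables (R : realType) (n : nat).
Implicit Types (x y c : 'rV[R]_n) (A F P : set 'rV[R]_n).
Implicit Types (alpha : 'I_n -> 'rV[R]_n) (W : set ('rV[R]_n -> 'rV[R]_n)).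

Definition dot x y : R := (x *m y^T) 0 0.

Definition simple_roots (X : diagram_family) alpha : Prop :=
  [/\ row_free (\matrix_(i < n) alpha i),
      (forall i j : 'I_n, (i < j)%N ->
         dot (alpha i) (alpha j) =
         - (Num.sqrt (dot (alpha i) (alpha i)) *
            Num.sqrt (dot (alpha j) (alpha j)) *
            cos (pi / (bond X n i j)%:R))) &
      (forall i j : 'I_n,
         dot (alpha i) (alpha i) * (sqlen X n j)%:R =
         dot (alpha j) (alpha j) * (sqlen X n i)%:R)].

Definition reflection alpha (k : 'I_n) x : 'rV[R]_n :=
  x - (2 * dot (alpha k) x / dot (alpha k) (alpha k)) *: alpha k.

(** The group generated by the reflections.  They are involutions, so words
    in the reflections suffice. *)
Definition reflection_group alpha : set ('rV[R]_n -> 'rV[R]_n) :=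
  [set w | exists s : seq 'I_n,
     w = foldr (fun k f => reflection alpha k \o f) idfun s].

Definition group_orbit W x : set 'rV[R]_n := [set w x | w in W].

Definition convex_hull A : set 'rV[R]_n :=
  smallest (fun B => convex_set (B : set (convex_lmodType 'rV[R]_n))) A.

(** Faces as intersections with supporting hyperplanes.  With c = 0 this
    includes P itself and the empty set, which have no dimension d < n in the
    sense of [has_dim] when P is full-dimensional. *)
Definition face P F : Prop :=
  exists c (b : R), (forall x, P x -> dot c x <= b) /\
                    F = P `&` [set x | dot c x = b].

(** F contains d + 1 affinely independent points p, p + row 0 M, ..., and lies
    in their affine span. *)
Definition has_dim F (d : nat) : Prop :=
  exists (p : 'rV[R]_n) (M : 'M[R]_(d, n)),
    [/\ row_free M, F p, (forall i, F (p + row i M)) &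
        (forall x, F x -> (x - p <= M)%MS)].

Definition platonic W P : Prop :=
  forall d : nat, (d < n)%N -> forall F F' : set 'rV[R]_n,
    face P F -> has_dim F d -> face P F' -> has_dim F' d ->
    exists2 w, W w & F' = w @` F.

Definition dominant alpha x : Prop := forall k, 0 <= dot (alpha k) x.

Definition gives_platonic (X : diagram_family) : Prop :=
  exists alpha,
    [/\ simple_roots X alpha,
        finite_set (reflection_group alpha) &
        exists x0, [/\ x0 <> 0, dominant alpha x0 &
          platonic (reflection_group alpha)
                   (convex_hull (group_orbit (reflection_group alpha) x0))]].

End Geometry.

(* Main.v *)
Require Import Defs.
From mathcomp Require Import all_boot all_order all_algebra.
From mathcomp Require Import all_classical all_reals all_analysis.
From mathcomp Require Import ring lra zify.

Set Implicit Arguments.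
Unset Strict Implicit.
Unset Printing Implicit Defensive.
Import Order.TTheory GRing.Theory Num.Theory.
Local Open Scope classical_set_scope.
Local Open Scope ring_scope.

(** Why the theorem holds.  Rescale the simple roots to vectors beta_k of
    squared length 2: the group W does not change, r_k x becomes
    x - <beta_k,x> beta_k, and <beta_i,beta_j> = - 2 cos (pi / m_ij).

    Everything rests on one classical fact, [dominant_ascends]: if x is
    dominant then x - w x is a nonnegative combination of the roots for all w
    in W, so two dominant points of one orbit are equal.  It is proved as a
    confluence statement.  Replace a point y by r_k y when <beta_k,y> < 0; the
    finiteness of W makes this process terminate, and a computation in the
    rank 2 subgroups ([ascents_join]) makes it locally confluent.  Hence each
    orbit contains exactly one dominant point, and all its points ascend to it.

    Let P be the convex hull of W x0.  A dominant c attains its maximum over P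
    at x0, and the face where it does so consists of the x in P such that
    x0 - x only involves the roots beta_k with <beta_k,c> = 0
    ([dominant_face]); up to W every face arises in this way.  When a set I of
    nodes can be enumerated so that each node k has <beta_k,x0> > 0 or is
    linked to an earlier one, applying the reflections to x0 in this order
    yields |I| + 1 affinely independent vertices, so the face of I has
    dimension |I| ([growing_dim]).

    In types D and E the diagram minus one of its three leaves is connected.
    At least two of these connected subdiagrams contain a node k with
    <beta_k,x0> > 0, hence two leaves yield facets.  Their outer normals are
    the corresponding two fundamental weights, which are dominant and distinct
    and so not conjugate: P is not Platonic ([fork_not_platonic]).

    When the diagram is a chain, take for x0 the fundamental weight of its
    first node.  If m is the first node with <beta_m,c> > 0, the nodes after m
    are cut off from the first one, and the face of c equals the face of
    {0, ..., m-1}, of dimension m.  So W acts transitively on the faces of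
    each dimension ([chain_platonic]).  The roots are realised by a Cholesky
    factorisation of their Gram matrix ([ex_chain]), and W is finite because
    it permutes a finite spanning set: the orbit of the first fundamental
    weight for A, B and C, an explicitly computed root system for F_4, H_3 and
    H_4. *)

(** * The dot product *)

Section DotProduct.
Variables (R : realType) (n : nat).
Implicit Types (x y z : 'rV[R]_n) (a : R).

Lemma dotE x y : dot x y = \sum_i x 0 i * y 0 i.
Proof. by rewrite /dot !mxE; apply: eq_bigr => i _; rewrite !mxE. Qed.

Lemma dotC x y : dot x y = dot y x.
Proof. by rewrite !dotE; apply: eq_bigr => i _; rewrite mulrC. Qed.

Lemma dotDl x y z : dot (x + y) z = dot x z + dot y z.
Proof. by rewrite /dot mulmxDl mxE. Qed.

Lemma dotZl a x y : dot (a *: x) y = a * dot x y.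
Proof. by rewrite /dot -scalemxAl mxE. Qed.

Lemma dotNl x y : dot (- x) y = - dot x y.
Proof. by rewrite -scaleN1r dotZl mulN1r. Qed.

Lemma dotBl x y z : dot (x - y) z = dot x z - dot y z.
Proof. by rewrite dotDl dotNl. Qed.

Lemma dotDr x y z : dot x (y + z) = dot x y + dot x z.
Proof. by rewrite !(dotC x) dotDl. Qed.

Lemma dotZr a x y : dot x (a *: y) = a * dot x y.
Proof. by rewrite !(dotC x) dotZl. Qed.

Lemma dotNr x y : dot x (- y) = - dot x y.
Proof. by rewrite !(dotC x) dotNl. Qed.

Lemma dotBr x y z : dot x (y - z) = dot x y - dot x z.
Proof. by rewrite dotDr dotNr. Qed.

Lemma dot0r x : dot x 0 = 0.
Proof. by rewrite -(scale0r x) dotZr mul0r. Qed.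

Lemma dot0l x : dot 0 x = 0.
Proof. by rewrite dotC dot0r. Qed.

Lemma dot_sumr x (I : Type) (s : seq I) (P : pred I) (f : I -> 'rV[R]_n) :
  dot x (\sum_(i <- s | P i) f i) = \sum_(i <- s | P i) dot x (f i).
Proof. by elim/big_rec2: _ => [|i a b _ <-]; rewrite ?dot0r ?dotDr. Qed.

Lemma dot_gt0 x : x != 0 -> 0 < dot x x.
Proof.
move=> x0; rewrite dotE lt_neqAle; apply/andP; split; last first.
  by apply: sumr_ge0 => i _; rewrite -expr2 sqr_ge0.
apply: contra_neq x0 => /esym /eqP.
rewrite psumr_eq0 => [/allP x0|i _]; last by rewrite -expr2 sqr_ge0.
apply/rowP => i; rewrite mxE; apply/eqP.
by have := x0 i (mem_index_enum i); rewrite mulf_eq0 orbb.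
Qed.

End DotProduct.

Definition dotr := (dotDl, dotDr, dotBl, dotBr, dotNl, dotNr, dotZl, dotZr,
  dot0l, dot0r).

(** * Reflections, words and orbit polytopes *)
Section ReflectionGroup.
Variables (R : realType) (n : nat) (beta : 'I_n -> 'rV[R]_n).
Hypothesis beta_norm : forall k, dot (beta k) (beta k) = 2.

Local Notation refl := (reflection beta).
Local Notation W := (reflection_group beta).

Lemma reflE k x : refl k x = x - dot (beta k) x *: beta k.
Proof. by rewrite /reflection beta_norm mulrAC divff ?mul1r. Qed.

Lemma dot_refl_self k x : dot (beta k) (refl k x) = - dot (beta k) x.
Proof. rewrite reflE !dotr beta_norm; lra. Qed.

Lemma reflK k : involutive (refl k).
Proof.
by move=> x; rewrite [LHS]reflE dot_refl_self scaleNr opprK reflE subrK.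
Qed.

Lemma dot_refl k x y : dot (refl k x) (refl k y) = dot x y.
Proof. rewrite !reflE !dotr beta_norm (dotC x (beta k)); ring. Qed.

Lemma refl_lin k a x y : refl k (a *: x + y) = a *: refl k x + refl k y.
Proof.
by rewrite !reflE dotDr dotZr scalerDl -scalerA scalerBr opprD addrACA.
Qed.

(** The elements of the group, in the shape in which it is defined; most
    arguments are inductions on such words. *)
Definition word (s : seq 'I_n) : 'rV[R]_n -> 'rV[R]_n :=
  foldr (fun k f => refl k \o f) idfun s.

Lemma word_cat s t x : word (s ++ t) x = word s (word t x).
Proof. by elim: s => //= k s <-. Qed.

Lemma dot_word s x y : dot (word s x) (word s y) = dot x y.
Proof. by elim: s => //= k s; rewrite dot_refl. Qed.

Lemma word_lin s a x y : word s (a *: x + y) = a *: word s x + word s y.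
Proof. by elim: s => //= k s ->; rewrite refl_lin. Qed.

Lemma word0 s : word s 0 = 0.
Proof. by have := word_lin s (-1) 0 0; rewrite scaleN1r oppr0 addr0 scaleN1r addNr. Qed.

Lemma wordZ s a x : word s (a *: x) = a *: word s x.
Proof. by rewrite -[a *: x]addr0 word_lin word0 addr0. Qed.

Lemma wordD s x y : word s (x + y) = word s x + word s y.
Proof. by rewrite -[x]scale1r word_lin !scale1r. Qed.

Lemma wordB s x y : word s (x - y) = word s x - word s y.
Proof. by rewrite wordD -scaleN1r wordZ scaleN1r. Qed.

Lemma wordK s : cancel (word s) (word (rev s)).
Proof.
by elim: s => //= k s IH x; rewrite rev_cons -cats1 word_cat /= reflK IH.
Qed.

Lemma dot_wordl s x y : dot (word s x) y = dot x (word (rev s) y).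
Proof. by rewrite -(dot_word (rev s)) wordK. Qed.

Section Hull.
Variable x0 : 'rV[R]_n.
Local Notation P := (convex_hull (group_orbit W x0)).

Lemma vertex_in s : P (word s x0).
Proof. by move=> B [_]; apply; exists (word s) => //; exists s. Qed.

(** The induction principle of the orbit polytope: check the vertices, then
    proper convex combinations. *)
Lemma hull_ind (Q : 'rV[R]_n -> Prop) :
  (forall s, Q (word s x0)) ->
  (forall x y t, 0 < t < 1 -> Q x -> Q y -> Q (t *: x + (1 - t) *: y)) ->
  forall x, P x -> Q x.
Proof.
move=> Qw Qc x; apply; split=> [|_ [_ [s ->] <-]]; last exact: Qw.
apply/convex_setW => a b /set_mem Qa /set_mem Qb t t0 t1; apply/mem_set.
by apply: Qc => //; rewrite t0 t1.
Qed.

Lemma hull_convex x y t :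
  0 < t < 1 -> P x -> P y -> P (t *: x + (1 - t) *: y).
Proof.
move=> /andP[t0 t1] Px Py B [Bc BG].
have Bx : B x by apply: Px.
have By : B y by apply: Py.
by apply/set_mem/(Bc x y (Itv01 (ltW t0) (ltW t1))); apply/mem_set.
Qed.

Lemma hull_word s x : P x -> P (word s x).
Proof.
move: x; apply: hull_ind => [t|x y t t01 Px Py].
  by rewrite -word_cat; apply: vertex_in.
by rewrite word_lin wordZ; apply: hull_convex.
Qed.

End Hull.
End ReflectionGroup.

(** * Coordinates with respect to a basis of roots *)

(** A function h can increase only finitely often along a finite set; this is
    what bounds the length of ascents inside a finite orbit. *)
Lemma ascending_ind (R : realType) (T : eqType) (S : seq T) (h : T -> R)
    (Q : T -> Prop) :
  (forall y, y \in S -> (forall z, z \in S -> h y < h z -> Q z) -> Q y) ->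
  forall y, y \in S -> Q y.
Proof.
move=> IH y; have [m] := ubnP (count (fun z => h y < h z) S).
elim: m y => // m IHm y cy yS; apply: IH => // z zS yz; apply: IHm => //.
rewrite ltnS in cy; apply: leq_trans cy; have /seq.permP pS := perm_to_rem zS.
rewrite !pS /= ltxx yz add0n add1n ltnS.
by apply: sub_count => x /=; apply: lt_trans.
Qed.

Section Basis.
Variables (R : realType) (n : nat) (beta : 'I_n -> 'rV[R]_n).
Hypothesis beta_free : row_free (\matrix_(i < n) beta i).

Let B := \matrix_(i < n) beta i.

(** The coordinate of v along beta_k. *)
Definition rcoef (v : 'rV[R]_n) (k : 'I_n) : R := (v *m invmx B) 0 k.

Lemma beta_unit : B \in unitmx.
Proof. by rewrite -row_free_unit. Qed.

Lemma rcoefE v : v = \sum_k rcoef v k *: beta k.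
Proof.
rewrite -{1}[v](mulmxKV beta_unit) mulmx_sum_row.
by apply: eq_bigr => k _; rewrite rowK.
Qed.

Lemma rcoefD v w k : rcoef (v + w) k = rcoef v k + rcoef w k.
Proof. by rewrite /rcoef mulmxDl mxE. Qed.

Lemma rcoefN v k : rcoef (- v) k = - rcoef v k.
Proof. by rewrite /rcoef mulNmx mxE. Qed.

Lemma rcoefZ a v k : rcoef (a *: v) k = a * rcoef v k.
Proof. by rewrite /rcoef -scalemxAl mxE. Qed.

Lemma rcoefB v w k : rcoef (v - w) k = rcoef v k - rcoef w k.
Proof. by rewrite rcoefD rcoefN. Qed.

Lemma rcoef0 k : rcoef 0 k = 0.
Proof. by rewrite /rcoef mul0mx mxE. Qed.

Lemma rcoef_beta i k : rcoef (beta i) k = (i == k)%:R.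
Proof.
rewrite /rcoef -[beta i](rowK beta) -row_mul mulmxV ?beta_unit//.
by rewrite !mxE.
Qed.

Lemma dot_coef c v : dot c v = \sum_k rcoef v k * dot c (beta k).
Proof.
by rewrite {1}[v]rcoefE dot_sumr; apply: eq_bigr => k _; rewrite dotZr.
Qed.

(** The vector with prescribed dot products with the roots, that is with
    prescribed coordinates in the basis of fundamental weights. *)
Definition dual_vec (f : 'I_n -> R) : 'rV[R]_n := (\row_k f k) *m (invmx B)^T.

Lemma dot_dual f k : dot (beta k) (dual_vec f) = f k.
Proof.
rewrite dotC; have -> : dot (dual_vec f) (beta k) = (dual_vec f *m B^T) 0 k.
  by rewrite mxE dotE; apply: eq_bigr => i _; rewrite !mxE.
by rewrite -mulmxA -trmx_mul mulmxV ?beta_unit// trmx1 mulmx1 mxE.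
Qed.

Lemma eq_dot v w : (forall k, dot (beta k) v = dot (beta k) w) -> v = w.
Proof.
move=> vw; apply/eqP; rewrite -subr_eq0; apply: contraT => /dot_gt0.
rewrite dot_coef big1 ?ltxx// => k _.
by rewrite dotC dotBr vw subrr mulr0.
Qed.

Lemma beta_neq0 k : beta k != 0.
Proof.
apply/eqP => b0; have := rcoef_beta k k.
by rewrite b0 rcoef0 eqxx => /esym/eqP; rewrite oner_eq0.
Qed.
End Basis.

(** * Ascents, and uniqueness of dominant points *)

(** The algebraic content of t = 2 cos (pi / m) for m = 2, 3, 4 and 5. *)
Definition coxeter_link (R : realType) (t : R) : Prop :=
  [\/ t = 0, t = 1, 0 < t /\ t ^+ 2 = 2 | 0 < t /\ t ^+ 2 = t + 1].

Lemma coxeter_link_ge0 (R : realType) (t : R) : coxeter_link t -> 0 <= t.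
Proof. by case=> [->|->|[/ltW]|[/ltW]]. Qed.

Section Ascent.
Variables (R : realType) (n : nat) (beta : 'I_n -> 'rV[R]_n).
Hypothesis beta_free : row_free (\matrix_(i < n) beta i).
Hypothesis beta_norm : forall k, dot (beta k) (beta k) = 2.
Hypothesis beta_link :
  forall i j, i != j -> coxeter_link (- dot (beta i) (beta j)).

Local Notation refl := (reflection beta).
Local Notation W := (reflection_group beta).
Local Notation word := (word beta).
Local Notation rcoef := (rcoef beta).

Lemma beta_obtuse i j : i != j -> dot (beta i) (beta j) <= 0.
Proof. by move=> /beta_link/coxeter_link_ge0; rewrite oppr_ge0. Qed.

(** Each step crosses a wall towards the dominant chamber and adds a positive
    multiple of a root. *)
Inductive ascends : 'rV[R]_n -> 'rV[R]_n -> Prop :=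
| ascends0 y : ascends y y
| ascendsS y z k :
    dot (beta k) y < 0 -> ascends (refl k y) z -> ascends y z.

Lemma ascends_trans x y z : ascends x y -> ascends y z -> ascends x z.
Proof. by elim=> // {}x {}y k xk _ IH /IH; apply: ascendsS. Qed.

Lemma ascends_coef y z k : ascends y z -> 0 <= rcoef (z - y) k.
Proof.
elim=> {y z} [y|y z i yi _ IH]; first by rewrite subrr rcoef0.
move: IH; rewrite reflE// !rcoefB rcoefZ rcoef_beta// => IH.
by case: (i == k) IH => /=; lra.
Qed.

Lemma ascends_dominant y z : dominant beta y -> ascends y z -> z = y.
Proof. by move=> /[swap]; case=> // {}y {}z k yk _ yd; rewrite ltNge yd in yk. Qed.

Lemma ascendsS' y y' z k v :
  dot (beta k) y = v -> v < 0 -> y - v *: beta k = y' ->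
  ascends y' z -> ascends y z.
Proof. by move=> <- yk <-; rewrite -reflE//; apply: ascendsS. Qed.

(** Local confluence: the two alternating sequences of m reflections starting
    with r_i and r_j both ascend at every step, and end at the same point
    because they are the two expressions of the longest element of the rank 2
    subgroup. *)
Lemma ascents_join y i j : dot (beta i) y < 0 -> dot (beta j) y < 0 ->
  exists2 u, ascends (refl i y) u & ascends (refl j y) u.
Proof.
have [<-{j}|ij] := eqVneq i j; first by exists (refl i y); apply: ascends0.
have [t tE] : exists t, - dot (beta i) (beta j) = t by eexists.
have := beta_link ij; rewrite tE !reflE//.
have bij : dot (beta i) (beta j) = - t by rewrite -tE opprK.
have bji : dot (beta j) (beta i) = - t by rewrite dotC.
have [a ya] : exists a, dot (beta i) y = a by eexists.
have [b yb] : exists b, dot (beta j) y = b by eexists.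
rewrite ya yb => tP a0 b0.
pose pt p q := y + p *: beta i + q *: beta j.
have stepi p q z v : a + 2 * p - t * q = v -> v < 0 ->
    ascends (pt (p - v) q) z -> ascends (pt p q) z.
  move=> <- v0; apply: (@ascendsS' _ _ _ i _ _ v0).
    by rewrite !dotr beta_norm ya bij; ring.
  by apply/rowP => l; rewrite !mxE; ring.
have stepj p q z v : b - t * p + 2 * q = v -> v < 0 ->
    ascends (pt p (q - v)) z -> ascends (pt p q) z.
  move=> <- v0; apply: (@ascendsS' _ _ _ j _ _ v0).
    by rewrite !dotr beta_norm yb bji; ring.
  by apply/rowP => l; rewrite !mxE; ring.
(* Both sequences stay in y + span (beta_i, beta_j); [pt p q] records the
   coordinates, so that each step becomes an identity between scalars. *)
have -> : y - a *: beta i = pt (- a) 0.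
  by rewrite /pt scale0r addr0 scaleNr.
have -> : y - b *: beta j = pt 0 (- b).
  by rewrite /pt scale0r addr0 scaleNr.
have done0 p q p' q' : p = p' -> q = q' -> ascends (pt p q) (pt p' q').
  by move=> -> ->; apply: ascends0.
case: tP => [t0|t1|[t0 t2]|[t0 t2]].
- exists (pt (- a) (- b)).
    by apply: (stepj _ _ _ b) => //; [rewrite t0|apply: done0]; ring.
  by apply: (stepi _ _ _ a) => //; [rewrite t0|apply: done0]; ring.
- exists (pt (- a - b) (- a - b)).
    apply: (stepj _ _ _ (a + b)); [rewrite t1; ring|lra|].
    by apply: (stepi _ _ _ b); [rewrite t1; ring|lra|apply: done0; ring].
  apply: (stepi _ _ _ (a + b)); [rewrite t1; ring|lra|].
  by apply: (stepj _ _ _ a); [rewrite t1; ring|lra|apply: done0; ring].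
- exists (pt (- (2 * a) - t * b) (- (2 * b) - t * a)).
    apply: (stepj _ _ _ (b + t * a)); [ring|nra|].
    apply: (stepi _ _ _ (a + t * b)); [ring: t2|nra|].
    by apply: (stepj _ _ _ b); [ring: t2|lra|apply: done0; ring].
  apply: (stepi _ _ _ (a + t * b)); [ring|nra|].
  apply: (stepj _ _ _ (b + t * a)); [ring: t2|nra|].
  by apply: (stepi _ _ _ a); [ring: t2|lra|apply: done0; ring].
- exists (pt (- ((1 + t) * (a + b))) (- ((1 + t) * (a + b)))).
    apply: (stepj _ _ _ (b + t * a)); [ring|nra|].
    apply: (stepi _ _ _ (t * (a + b))); [ring: t2|nra|].
    apply: (stepj _ _ _ (a + t * b)); [ring: t2|nra|].
    by apply: (stepi _ _ _ b); [ring: t2|lra|apply: done0; ring].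
  apply: (stepi _ _ _ (a + t * b)); [ring|nra|].
  apply: (stepj _ _ _ (t * (a + b))); [ring: t2|nra|].
  apply: (stepi _ _ _ (b + t * a)); [ring: t2|nra|].
  by apply: (stepj _ _ _ a); [ring: t2|lra|apply: done0; ring].
Qed.

Section FiniteOrbit.
Variable V : seq 'rV[R]_n.
Hypothesis V_stable : forall y k, y \in V -> refl k y \in V.

(** Termination: the functional rho with value 1 on each root increases along
    ascents. *)
Lemma height_ind (Q : 'rV[R]_n -> Prop) :
  (forall y, y \in V ->
    (forall k, dot (beta k) y < 0 -> Q (refl k y)) -> Q y) ->
  forall y, y \in V -> Q y.
Proof.
move=> IH; pose rho := dual_vec beta (fun=> 1).
apply: (ascending_ind (h := dot rho)) => y yO IHy.
apply: IH => // k yk; apply: IHy; first exact: V_stable.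
by rewrite reflE// !dotr [dot rho (beta k)]dotC dot_dual//; lra.
Qed.

Lemma ascends_stable y z : ascends y z -> y \in V -> z \in V.
Proof. by elim=> // {}y {}z k _ _ IH /(V_stable k). Qed.

Lemma ex_dominant y : y \in V -> exists2 z, dominant beta z & ascends y z.
Proof.
move: y; apply: height_ind => y _ IH.
have [yd|/existsNP[k /negP]] := pselect (dominant beta y).
  by exists y => //; apply: ascends0.
rewrite -ltNge => yk; have [z zd yz] := IH k yk.
by exists z => //; apply: ascendsS yk yz.
Qed.

(** Newman's lemma: termination and local confluence make normal forms
    unique. *)
Lemma dominant_unique y : y \in V -> forall z1 z2, dominant beta z1 ->
  dominant beta z2 -> ascends y z1 -> ascends y z2 -> z1 = z2.
Proof.
move: y; apply: height_ind => y yO IH z1 z2 z1d z2d yz1 yz2.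
case: yz1 z1d yz2 yO IH => [{}y|{}y {}z1 i yi iz1] z1d yz2 yO IH.
  by rewrite (ascends_dominant z1d yz2).
case: yz2 z2d yi iz1 yO IH => [{}y|{}y {}z2 j yj jz2] z2d yi iz1 yO IH.
  by move: (z2d i); rewrite leNgt yi.
have [u iu ju] := ascents_join yi yj.
have uO := ascends_stable iu (V_stable i yO).
have [z zd uz] := ex_dominant uO.
rewrite (IH i yi z1 z) //; last exact: ascends_trans iu uz.
by apply: (IH j yj) => //; apply: ascends_trans ju uz.
Qed.

(** By uniqueness, the dominant point reached from y does not change when y is
    replaced by r_k y: if they differ, one of the two ascends to the other. *)
Lemma ascends_orbit x s : x \in V -> dominant beta x -> ascends (word s x) x.
Proof.
move=> xO xd; elim: s => [|k s IH] /=; first exact: ascends0.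
have wO : word s x \in V by elim: s {IH} => //= j s; apply: V_stable.
have [y0|y0|y0] := ltgtP (dot (beta k) (word s x)) 0.
- have [z zd wz] := ex_dominant (V_stable k wO).
  by move: (wz); rewrite (dominant_unique wO zd xd (ascendsS y0 wz) IH).
- by apply: (@ascendsS _ _ k); rewrite ?reflK// dot_refl_self// oppr_lt0.
- by rewrite reflE// y0 scale0r subr0.
Qed.
End FiniteOrbit.

Hypothesis W_finite : finite_set W.

Lemma orbit_seq x : exists V : seq 'rV[R]_n, x \in V /\
  forall y k, y \in V -> refl k y \in V.
Proof.
have /finite_seqP [V VE] := finite_image (fun w => w x) W_finite.
have VP y : y \in V <-> exists s, y = word s x.
  change (y \in V : Prop) with ([set` V] y).
  rewrite -VE; split => [[_ [s ->] <-]|[s ->]]; first by exists s.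
  by exists (word s) => //; exists s.
exists V; split=> [|y k /VP[s ->]]; apply/VP; first by exists [::].
by exists (k :: s).
Qed.

Lemma dominant_ascends x s : dominant beta x -> ascends (word s x) x.
Proof. by have [V [xO Vk]] := orbit_seq x; apply: ascends_orbit Vk _ _ xO. Qed.

(** The closed dominant chamber meets each orbit at most once. *)
Lemma dominant_fundamental x s :
  dominant beta x -> dominant beta (word s x) -> word s x = x.
Proof.
by move=> xd wd; apply/esym/(ascends_dominant wd)/dominant_ascends.
Qed.

Lemma ex_word_dominant x : exists s, dominant beta (word s x).
Proof.
have [V [xO Vk]] := orbit_seq x.
have [z zd xz] := ex_dominant Vk xO; elim: xz zd => {x xO z} [y yd|y z k _ _ IH zd].
  by exists [::].
by have [s sd] := IH zd; exists (s ++ [:: k]); rewrite word_cat.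
Qed.

End Ascent.

(** * Dimension *)
Section Dimension.
Variables (R : realType) (n : nat).
Implicit Types F : set 'rV[R]_n.

Lemma has_dim_le F d d' : has_dim F d -> has_dim F d' -> (d' <= d)%N.
Proof.
move=> [p [M [_ Fp FM FsubM]]] [q [N [Nfree Fq FN _]]].
have NM : (N <= M)%MS.
  apply/row_subP => i; have -> : row i N = (q + row i N - p) - (q - p).
    by rewrite opprB addrA subrK addrC addKr.
  by rewrite addmx_sub ?eqmx_opp ?FsubM.
by rewrite -(eqP Nfree); apply: leq_trans (mxrankS NM) (rank_leq_row M).
Qed.

Lemma has_dim_unique F d d' : has_dim F d -> has_dim F d' -> d = d'.
Proof.
by move=> Fd Fd'; apply/eqP; rewrite eqn_leq (has_dim_le Fd') ?(has_dim_le Fd).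
Qed.

Variable beta : 'I_n -> 'rV[R]_n.
Hypothesis beta_norm : forall k, dot (beta k) (beta k) = 2.

Lemma word_mulmx s d (u : 'rV[R]_d) (M : 'M[R]_(d, n)) :
  word beta s (u *m M) = u *m \matrix_i word beta s (row i M).
Proof.
rewrite !mulmx_sum_row; elim/big_rec2: _ => [|i y x _ <-]; first exact: word0.
by rewrite rowK word_lin.
Qed.

Lemma has_dim_word s F d : has_dim F d -> has_dim (word beta s @` F) d.
Proof.
move=> [p [M [Mfree Fp FM FsubM]]]; exists (word beta s p).
exists (\matrix_i word beta s (row i M)); split.
- apply: inj_row_free => u; rewrite -word_mulmx => /(congr1 (word beta (rev s))).
  rewrite wordK// word0// => uM.
  by apply: (row_free_inj Mfree); rewrite uM mul0mx.
- by exists p.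
- by move=> i; exists (p + row i M) => //; rewrite rowK wordD.
- move=> _ [x Fx <-]; rewrite -wordB//.
  have /submxP[u ->] := FsubM x Fx.
  by rewrite word_mulmx submxMl.
Qed.
End Dimension.

(** * Faces of the orbit polytope *)
Section Polytope.
Variables (R : realType) (n : nat) (beta : 'I_n -> 'rV[R]_n).
Hypothesis beta_free : row_free (\matrix_(i < n) beta i).
Hypothesis beta_norm : forall k, dot (beta k) (beta k) = 2.
Hypothesis beta_link :
  forall i j, i != j -> coxeter_link (- dot (beta i) (beta j)).
Hypothesis W_finite : finite_set (reflection_group beta).

Variable x0 : 'rV[R]_n.
Hypothesis x0_dominant : dominant beta x0.

Local Notation refl := (reflection beta).
Local Notation W := (reflection_group beta).
Local Notation word := (word beta).
Local Notation rcoef := (rcoef beta).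
Local Notation P := (convex_hull (group_orbit W x0)).

Lemma rcoef_conv (x y : 'rV[R]_n) t k :
  rcoef (x0 - (t *: x + (1 - t) *: y)) k =
  t * rcoef (x0 - x) k + (1 - t) * rcoef (x0 - y) k.
Proof. by rewrite !rcoefB rcoefD !rcoefZ; ring. Qed.

(** The polytope lies in the cone x0 - sum_k R_+ beta_k: this holds for its
    vertices by [dominant_ascends], and the cone is convex. *)
Lemma hull_coef_ge0 x k : P x -> 0 <= rcoef (x0 - x) k.
Proof.
move: x; apply: hull_ind => [s|x y t /andP[t0 t1] IHx IHy].
  by apply: ascends_coef => //; apply: dominant_ascends.
rewrite rcoef_conv; nra.
Qed.

(** The face at x0 spanned by the roots of the nodes in I. *)
Definition std_face (I : pred 'I_n) : set 'rV[R]_n :=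
  P `&` [set x | forall k, ~~ I k -> rcoef (x0 - x) k = 0].

Lemma dominant_le c x : dominant beta c -> P x -> dot c x <= dot c x0.
Proof.
move=> cd Px; rewrite -subr_ge0 -dotBr (dot_coef beta_free).
by apply: sumr_ge0 => k _; rewrite mulr_ge0 ?hull_coef_ge0// dotC.
Qed.

(** On the polytope, <c,x0> - <c,x> is a sum of nonnegative terms, one for each
    node; it vanishes when all of them do. *)
Lemma dominant_face c : dominant beta c ->
  P `&` [set x | dot c x = dot c x0] = std_face (fun k => dot (beta k) c == 0).
Proof.
move=> cd; have ge0 x k : P x -> 0 <= rcoef (x0 - x) k * dot c (beta k).
  by move=> Px; rewrite mulr_ge0 ?hull_coef_ge0// dotC.
apply/seteqP; split=> x [Px /= xc]; split=> //=.
  move=> k kc; have /eqP : dot c (x0 - x) = 0 by rewrite dotBr xc subrr.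
  rewrite (dot_coef beta_free) psumr_eq0; last by move=> i _; apply: ge0.
  move=> /allP /(_ k (mem_index_enum k)); rewrite dotC mulf_eq0 (negPf kc) orbF.
  by move=> /eqP.
apply/esym/eqP; rewrite -subr_eq0 -dotBr (dot_coef beta_free).
rewrite big1// => k _; have [ck|/xc ->] := eqVneq (dot (beta k) c) 0.
  by rewrite dotC ck mulr0.
by rewrite mul0r.
Qed.

Lemma eq_std_face (I J : pred 'I_n) : I =1 J -> std_face I = std_face J.
Proof. by move=> /funext ->. Qed.

Lemma face_functional (I : pred 'I_n) : exists2 c, dominant beta c &
  forall k, dot (beta k) c = (~~ I k)%:R.
Proof.
by exists (dual_vec beta (fun k => (~~ I k)%:R)) => k; rewrite dot_dual.
Qed.

Lemma std_face_functional (I : pred 'I_n) c :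
  dominant beta c -> (forall k, dot (beta k) c = (~~ I k)%:R) ->
  P `&` [set x | dot c x = dot c x0] = std_face I.
Proof.
move=> cd cE; rewrite dominant_face//; apply: eq_std_face => k.
by rewrite cE; case: (I k); rewrite ?eqxx ?oner_eq0.
Qed.

Lemma std_face_face I : face P (std_face I).
Proof.
have [c cd cE] := face_functional I.
exists c, (dot c x0); split=> [x|]; first exact: dominant_le.
by rewrite -(std_face_functional cd cE).
Qed.

(** Enumerations along which the reflections move x0 at each step: a new node k
    moves the current vertex because k moves x0 itself, or because the vertex
    has already travelled along a root that forms an obtuse angle with
    beta_k. *)
Inductive growing : seq 'I_n -> Prop :=
| growing0 : growing [::]
| growingS s k : growing s -> k \notin s ->
    0 < dot (beta k) x0 \/ (exists2 i, i \in s & dot (beta k) (beta i) < 0) ->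
    growing (rcons s k).

(* The vertex reached after applying the reflections of s in order. *)
Local Notation tip s := (word (rev s) x0).

Lemma tip_rcons s k : tip (rcons s k) = refl k (tip s).
Proof. by rewrite rev_rcons. Qed.

Lemma growing_rcons s k : growing (rcons s k) ->
  [/\ growing s, k \notin s &
    0 < dot (beta k) x0 \/ (exists2 i, i \in s & dot (beta k) (beta i) < 0)].
Proof.
move e: (rcons s k) => u gu; case: gu e => [|{}u k' gu ku H].
  by case: s.
by move=> /eqP; rewrite eqseq_rcons => /andP[/eqP -> /eqP ->].
Qed.

(** The vertex reached has moved along exactly the roots of s, and the next
    reflection moves it further.  The two facts feed each other in the
    induction. *)
Lemma growing_coef s : growing s ->
  (forall k, k \in s -> 0 < rcoef (x0 - tip s) k) /\
  (forall k, k \notin s -> rcoef (x0 - tip s) k = 0) /\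
  (forall k, growing (rcons s k) -> 0 < dot (beta k) (tip s)).
Proof.
have step u : (forall k, k \in u -> 0 < rcoef (x0 - tip u) k) ->
    (forall k, k \notin u -> rcoef (x0 - tip u) k = 0) ->
    forall k, growing (rcons u k) -> 0 < dot (beta k) (tip u).
  move=> pos zero k /growing_rcons[_ ks kx].
  have -> : dot (beta k) (tip u) =
      dot (beta k) x0 - dot (beta k) (x0 - tip u) by rewrite dotBr; ring.
  rewrite [dot _ (x0 - _)](dot_coef beta_free) subr_gt0.
  have le0 j : rcoef (x0 - tip u) j * dot (beta k) (beta j) <= 0.
    have [js|/zero ->] := boolP (j \in u); last by rewrite mul0r.
    rewrite mulr_ge0_le0 ?(ltW (pos _ _))// beta_obtuse//.
    by apply: contraNneq ks => ->.
  case: kx => [kx|[i ui ki]]; first by apply: le_lt_trans _ kx; apply: sumr_le0.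
  apply: lt_le_trans _ (x0_dominant k).
  rewrite (bigD1 i)//=; apply: (@le_lt_trans _ _ (rcoef (x0 - tip u) i * dot (beta k) (beta i))).
    by rewrite gerDl sumr_le0.
  by rewrite nmulr_llt0// pos.
elim=> [|{}s k gs [pos [zero next]] ks kx].
  have z k : rcoef (x0 - tip [::]) k = 0 by rewrite subrr rcoef0.
  by split=> //; split=> // k; apply: step.
have yk : 0 < dot (beta k) (tip s) by apply: next; apply: growingS.
have E j : rcoef (x0 - tip (rcons s k)) j =
    rcoef (x0 - tip s) j + dot (beta k) (tip s) * (k == j)%:R.
  by rewrite tip_rcons reflE// !rcoefB rcoefZ rcoef_beta//; ring.
have pos' j : j \in rcons s k -> 0 < rcoef (x0 - tip (rcons s k)) j.
  rewrite mem_rcons inE E; have [->|_] := eqVneq j k => /= [_|js].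
    by rewrite zero// add0r mulr1.
  by rewrite mulr0 addr0 pos.
have zero' j : j \notin rcons s k -> rcoef (x0 - tip (rcons s k)) j = 0.
  rewrite mem_rcons inE negb_or E eq_sym => /andP[/negPf -> /zero ->].
  by rewrite mulr0 addr0.
by split=> //; split=> // j; apply: step.
Qed.

Lemma growing_take s i : growing s -> growing (take i s).
Proof.
elim=> [|{}s k gs IH ks kx]; first exact: growing0.
have [si|si] := ltnP (size s) i.
  by rewrite take_oversize ?size_rcons//; apply: growingS.
by rewrite -cats1 takel_cat.
Qed.

Lemma growing_uniq s : growing s -> uniq s.
Proof. by elim=> // {}s k _ us ks _; rewrite rcons_uniq ks. Qed.

Lemma tip_in_face s i : growing s -> std_face (mem s) (tip (take i s)).
Proof.
move=> gs; split=> [|k ks] /=; first exact: vertex_in.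
have [_ [zero _]] := growing_coef (growing_take i gs).
by apply: zero; apply: contra ks; apply: mem_take.
Qed.

Lemma growing_edge s (i : 'I_(size s)) : growing s ->
  exists2 p, 0 < p & tip (take i s) - tip (take i.+1 s) =
                     p *: beta (tnth (in_tuple s) i).
Proof.
move=> gs; set k := tnth _ i.
have E : take i.+1 s = rcons (take i s) k.
  by rewrite (take_nth k)// -(tnth_nth k (in_tuple s)).
have [_ [_ next]] := growing_coef (growing_take i gs).
exists (dot (beta k) (tip (take i s))).
  by apply: next; rewrite -E; apply: growing_take.
by rewrite E tip_rcons reflE// opprB addrC subrK.
Qed.

(** The vertices met along the enumeration span the face: each beta_k with k
    in s is proportional to the difference of two consecutive ones. *)
Lemma growing_dim s : growing s -> has_dim (std_face (mem s)) (size s).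
Proof.
move=> gs; set d := size s.
pose M := \matrix_(i < d) (tip (take i.+1 s) - x0).
have tipM (i : nat) : (i <= d)%N -> (tip (take i s) - x0 <= M)%MS.
  case: i => [_|i id]; first by rewrite take0 subrr sub0mx.
  by have := row_sub (Ordinal id) M; rewrite rowK.
have betaM k : k \in s -> (beta k <= M)%MS.
  move=> /(tnthP (in_tuple s))[i ->].
  have [p p0 pE] := growing_edge i gs.
  rewrite -(eqmx_scale _ (lt0r_neq0 p0)) -pE.
  have -> : tip (take i s) - tip (take i.+1 s) =
      (tip (take i s) - x0) - (tip (take i.+1 s) - x0).
    by rewrite opprB addrA subrK.
  by rewrite addmx_sub ?eqmx_opp ?tipM// ltnW.
pose N := \matrix_(i < d) beta (tnth (in_tuple s) i).
have NM : (N <= M)%MS.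
  by apply/row_subP => i; rewrite rowK betaM// mem_tnth.
have Nfree : row_free N.
  apply: inj_row_free => u uN; apply/rowP => j; rewrite mxE.
  have := rcoef0 beta (tnth (in_tuple s) j); rewrite -uN.
  rewrite mulmx_sum_row.
  rewrite (big_morph (fun v => rcoef v (tnth (in_tuple s) j))
            (fun v w => rcoefD beta v w _) (rcoef0 beta _)).
  rewrite (bigD1 j)//= big1 => [|i ij].
    by rewrite addr0 rowK rcoefZ rcoef_beta// eqxx mulr1.
  rewrite rowK rcoefZ rcoef_beta// (inj_eq (@tuple_uniqP _ _ (in_tuple s) _)).
    by rewrite (negPf ij) mulr0.
  exact: growing_uniq gs.
exists x0, M; split.
- by rewrite /row_free eqn_leq rank_leq_row -{1}(eqP Nfree) mxrankS.
- by have := tip_in_face 0 gs; rewrite take0.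
- by move=> i; rewrite rowK addrC subrK; apply: tip_in_face.
- move=> x [_ /= xs]; rewrite -opprB eqmx_opp [x0 - x](rcoefE beta_free).
  apply: summx_sub => k _; have [ks|/xs ->] := boolP (k \in s).
    by rewrite scalemx_sub// betaM.
  by rewrite scale0r sub0mx.
Qed.

(** A conjugation w between the two facets maps the functional c attaining its
    maximum on the first one to a functional attaining its maximum on the
    second one.  That makes w c dominant, hence equal to c; but c vanishes on
    all roots but that of i1, and w c on all roots but that of i2. *)
Lemma two_facets_not_platonic i1 i2 s1 s2 : i1 != i2 ->
  growing s1 -> growing (rcons s2 i2) ->
  (forall k, (k \in s1) = (k != i1)) -> (forall k, (k \in s2) = (k != i2)) ->
  ~ platonic W P.
Proof.
move=> i12 gs1 gs2i s1E s2E plat.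
have [gs2 _ _] := growing_rcons gs2i.
have size_compl (i : 'I_n) s : growing s -> (forall k, (k \in s) = (k != i)) ->
    size s = n.-1.
  move=> gs sE; rewrite -(card_uniqP (growing_uniq gs)) (eq_card sE).
  by rewrite cardC1 card_ord.
have dim1 := growing_dim gs1; have dim2 := growing_dim gs2.
rewrite (size_compl i1)// in dim1; rewrite (size_compl i2)// in dim2.
have n1 : (n.-1 < n)%N by rewrite ltn_predL (leq_ltn_trans _ (ltn_ord i1)).
have [_ [t ->] s2im] := plat _ n1 _ _ (std_face_face _) dim1
  (std_face_face _) dim2.
have [c cd cE] := face_functional (mem s1).
have cw_le x : P x -> dot (word t c) x <= dot c x0.
  by move=> Px; rewrite dot_wordl// dominant_le//; apply: hull_word.
have cw_eq x : std_face (mem s2) x -> dot (word t c) x = dot c x0.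
  rewrite s2im => -[y]; rewrite -(std_face_functional cd cE) => -[_ /= yE] <-.
  by rewrite dot_word.
have tip2 j : std_face (mem s2) (tip (take j s2)) by apply: tip_in_face.
have cw0 k : k \in s2 -> dot (beta k) (word t c) = 0.
  move=> /(tnthP (in_tuple s2))[j ->].
  have [p p0 pE] := growing_edge j gs2; apply/eqP.
  rewrite dotC -(mulrI_eq0 _ (mulfI (lt0r_neq0 p0))) -dotZr -pE dotBr.
  by rewrite !cw_eq ?subrr.
(* The vertex one step beyond the second facet, in the direction of i2,
   determines the sign of w c on beta_(i2). *)
have cw_i2 : 0 <= dot (beta i2) (word t c).
  have [_ [_ /(_ _ gs2i) p0]] := growing_coef gs2.
  rewrite dotC -(pmulr_rge0 _ p0) -dotZr.
  have -> : dot (beta i2) (tip s2) *: beta i2 = tip s2 - refl i2 (tip s2).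
    by rewrite reflE// opprB addrC subrK.
  rewrite dotBr subr_ge0; have := tip2 (size s2); rewrite take_size => /cw_eq ->.
  by rewrite -tip_rcons; apply: cw_le; apply: vertex_in.
have cwd : dominant beta (word t c).
  move=> k; have [->//|ki2] := eqVneq k i2.
  by rewrite cw0// s2E.
have := cE i1; rewrite -(dominant_fundamental _ _ _ _ cd cwd)// cw0 ?s2E//.
by rewrite /= s1E eqxx => /esym/eqP; rewrite oner_eq0.
Qed.

(** A longest enumeration inside I cannot be prolonged: no remaining node of I
    moves x0 or is linked to an enumerated one. *)
Lemma ex_growing_closed (I : pred 'I_n) : exists2 s, growing s &
  (forall k, k \in s -> I k) /\
  (forall k, I k -> k \notin s -> ~ 0 < dot (beta k) x0 /\
     forall i, i \in s -> ~ dot (beta k) (beta i) < 0).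
Proof.
suff: forall m s, growing s -> (forall k, k \in s -> I k) ->
    (n - size s < m)%N -> exists2 s, growing s &
  (forall k, k \in s -> I k) /\
  (forall k, I k -> k \notin s -> ~ 0 < dot (beta k) x0 /\
     forall i, i \in s -> ~ dot (beta k) (beta i) < 0).
  by move=> /(_ n.+1 [::]); apply=> //; [apply: growing0|rewrite subn0].
elim=> // m IH s gs sI sm.
have [|/existsNP[k kx]] := pselect (forall k, I k -> k \notin s ->
   ~ 0 < dot (beta k) x0 /\ forall i, i \in s -> ~ dot (beta k) (beta i) < 0).
  by move=> sclosed; exists s.
have [Ik [ks Ek]] : I k /\ k \notin s /\ (0 < dot (beta k) x0 \/
    exists2 i, i \in s & dot (beta k) (beta i) < 0).
  apply: contrapT => none; apply: kx => Ik ks.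
  split=> [kx0|i si ki]; apply: none; split=> //; split=> //; first by left.
  by right; exists i.
have gk := growingS gs ks Ek.
apply: (IH _ gk) => [j|].
  by rewrite mem_rcons inE => /orP[/eqP -> //|]; apply: sI.
have : (size (rcons s k) <= n)%N.
  rewrite -(card_uniqP (growing_uniq gk)).
  by apply: leq_trans (max_card _) _; rewrite card_ord.
by rewrite size_rcons; move: sm; lia.
Qed.

(** * Diagrams with a fork *)

(** The nodes 0, ..., n-2 form a chain and n-1 is attached to the inner node a
    of this chain. *)
Section Fork.
Variable a : nat.
Hypothesis a_inner : (0 < a < n - 2)%N.
Hypothesis beta_fork : forall i j : 'I_n, (i < j)%N ->
  (if j == n.-1 :> nat then i == a :> nat else j == i.+1 :> nat) ->
  dot (beta i) (beta j) < 0.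

Let leaf (l : 'I_n) := [\/ l = 0 :> nat, l = n - 2 :> nat | l = n.-1 :> nat]%N.

(** The diagram minus a leaf l is connected: a set s of nodes that is closed
    under links avoiding l and meets this subdiagram exhausts it.  One walks
    along the chain to the node a, and from there to any other node. *)
Section Connected.
Variables (s : seq 'I_n) (l : 'I_n).
Hypothesis s_closed : forall i k : 'I_n,
  i \in s -> k != l -> dot (beta k) (beta i) < 0 -> k \in s.

Lemma fork_up (p k : 'I_n) : p \in s -> (p <= k)%N -> (k < n.-1)%N ->
  (l <= p)%N || (k < l)%N -> k \in s.
Proof.
move: k => [q qn] /=; elim: q qn => [|q IH] qn ps pq qn1 lpq.
  by rewrite (_ : Ordinal qn = p)//; apply: val_inj => /=; lia.
have [pq'|pq'] := ltnP q p.
  by rewrite (_ : Ordinal qn = p)//; apply: val_inj => /=; lia.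
have qn' := ltnW qn; apply: (@s_closed (Ordinal qn')).
- by apply: IH => //; lia.
- by apply/negP => /eqP /(congr1 val) /=; lia.
- by rewrite dotC; apply: beta_fork => //=; rewrite ltn_eqF.
Qed.

Lemma fork_down (p k : 'I_n) : p \in s -> (k <= p)%N -> (p < n.-1)%N ->
  (p <= l)%N || (l < k)%N -> k \in s.
Proof.
move=> ps kp pn lkp; move: {-1}(p - k)%N (erefl (p - k)%N) => d.
elim: d k kp lkp => [|d IH] k kp lkp dE.
  by rewrite (_ : k = p)//; apply: val_inj => /=; lia.
have kn : (k.+1 < n)%N by lia.
apply: (@s_closed (Ordinal kn)).
- by apply: IH => /=; lia.
- by apply/negP => /eqP /(congr1 val) /=; lia.
- by apply: beta_fork => //=; rewrite ltn_eqF//; lia.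
Qed.

Lemma fork_connected k0 k : leaf l -> k0 \in s -> k0 != l -> k != l -> k \in s.
Proof.
move=> lleaf k0s k0l kl; have an : (a < n)%N by lia.
have k0l' : k0 <> l :> nat by move=> /val_inj/eqP; rewrite (negPf k0l).
have kl' : k <> l :> nat by move=> /val_inj/eqP; rewrite (negPf kl).
have la : Ordinal an != l.
  by apply/negP => /eqP /(congr1 val) /= la; case: lleaf; lia.
have as_ : Ordinal an \in s.
  have [k0n|k0n] := eqVneq (k0 : nat) n.-1.
    by apply: (s_closed k0s) => //; apply: beta_fork; rewrite /= k0n ?eqxx//; lia.
  have [ak|ka] := leqP a k0.
    by apply: (fork_down k0s) => //=; [|case: lleaf]; have := ltn_ord k0; lia.
  by apply: (fork_up k0s) => /=; [| |case: lleaf]; lia.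
have [kn|kn] := eqVneq (k : nat) n.-1.
  apply: (s_closed as_) => //; rewrite dotC; apply: beta_fork; rewrite /= kn ?eqxx//.
  lia.
have [ak|ka] := leqP k a.
  by apply: (fork_down as_) => //=; [|case: lleaf]; lia.
by apply: (fork_up as_) => /=; [| |case: lleaf]; have := ltn_ord k; lia.
Qed.
End Connected.

Lemma fork_growing l k0 : leaf l -> k0 != l -> 0 < dot (beta k0) x0 ->
  exists2 s, growing s & forall k, (k \in s) = (k != l).
Proof.
move=> lleaf k0l k0x; have [s gs [sl sclosed]] := ex_growing_closed (predC1 l).
exists s => // k; apply/idP/idP => [/sl//|kl].
have k0s : k0 \in s.
  by apply: contrapT => /negP k0s; have [] := sclosed k0 k0l k0s.
apply: (fork_connected (l := l)) k0s k0l kl => // i j si jl ji.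
by apply: contrapT => /negP js; have [_ /(_ i si)] := sclosed j jl js.
Qed.

Lemma leaf_growing l s : leaf l -> growing s ->
  (forall k, (k \in s) = (k != l)) -> growing (rcons s l).
Proof.
move=> lleaf gs sE; apply: growingS => //; first by rewrite sE eqxx.
have an : (a < n)%N by lia.
right; case: lleaf => ll.
- have n1 : (1 < n)%N by lia.
  exists (Ordinal n1); first by rewrite sE; apply/negP => /eqP /(congr1 val) /=; lia.
  by apply: beta_fork => /=; rewrite ll// ltn_eqF//; lia.
- have n1 : (n - 3 < n)%N by lia.
  exists (Ordinal n1); first by rewrite sE; apply/negP => /eqP /(congr1 val) /=; lia.
  rewrite dotC; apply: beta_fork => /=; first by lia.
  by rewrite ltn_eqF; lia.
- exists (Ordinal an); first by rewrite sE; apply/negP => /eqP /(congr1 val) /=; lia.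
  by rewrite dotC; apply: beta_fork => /=; [lia|rewrite ll !eqxx].
Qed.

(** At most one of the three leaves coincides with the chosen node k0 that
    moves x0, and each of the other leaves yields a facet. *)
Lemma fork_not_platonic : x0 <> 0 -> ~ platonic W P.
Proof.
move=> x0n0; have [k0 k0x] : exists k, 0 < dot (beta k) x0.
  apply: contrapT => /forallNP none; apply: x0n0.
  apply/eqP; apply: contrapT => /negP /dot_gt0; rewrite (dot_coef beta_free).
  rewrite big1 ?ltxx// => k _; rewrite dotC.
  have := x0_dominant k; rewrite le_eqVlt => /orP[/eqP <-|kx].
    by rewrite mulr0.
  by have := none k kx.
have two l1 l2 : leaf l1 -> leaf l2 -> l1 != l2 -> k0 != l1 -> k0 != l2 ->
    ~ platonic W P.
  move=> leaf1 leaf2 l12 k1 k2.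
  have [s1 gs1 s1E] := fork_growing leaf1 k1 k0x.
  have [s2 gs2 s2E] := fork_growing leaf2 k2 k0x.
  exact: (two_facets_not_platonic l12 gs1 (leaf_growing leaf2 gs2 s2E)).
have n0 : (0 < n)%N by lia.
have n2 : (n - 2 < n)%N by lia.
have n1 : (n.-1 < n)%N by lia.
have neq (i j : 'I_n) : i <> j :> nat -> i != j.
  by move=> ij; apply/negP => /eqP /(congr1 val).
have leaf0 : leaf (Ordinal n0) by constructor 1.
have leaf2 : leaf (Ordinal n2) by constructor 2.
have leaf1 : leaf (Ordinal n1) by constructor 3.
have [k01|k01] := eqVneq (k0 : nat) n.-1.
  by apply: (two _ _ leaf0 leaf2); apply: neq => /=; lia.
have [k02|k02] := eqVneq (k0 : nat) (n - 2)%N.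
  by apply: (two _ _ leaf0 leaf1); apply: neq => /=; lia.
by apply: (two _ _ leaf2 leaf1); apply: neq => /=; lia.
Qed.
End Fork.

(** * Chains *)

(** The seed is a positive multiple of the first fundamental weight. *)
Section Chain.
Hypothesis x0_first : forall k : 'I_n, (0 < dot (beta k) x0) = (k == 0 :> nat).
Hypothesis beta_chain : forall i j : 'I_n, (i < j)%N ->
  (dot (beta i) (beta j) < 0) = (j == i.+1 :> nat).

Lemma chain_orthogonal (i j : 'I_n) : (i.+1 < j)%N -> dot (beta i) (beta j) = 0.
Proof.
move=> ij; have ij' : (i < j)%N by apply: ltnW.
apply/eqP; rewrite eq_le beta_obtuse//=; last first.
  by apply: contraTneq ij' => ->; rewrite ltnn.
by rewrite leNgt beta_chain// gtn_eqF.
Qed.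

(** Descend from x0 to a vertex.  As long as no step is taken along beta_m, the
    roots used have indices below m, or are orthogonal to these and to x0; the
    latter fix the current vertex, so a step along them cannot occur. *)
Lemma chain_vertex (m : 'I_n) y z : z = x0 -> ascends beta y z ->
  rcoef (z - y) m = 0 -> forall k : 'I_n, (m < k)%N -> rcoef (z - y) k = 0.
Proof.
move=> zx0 yz; elim: yz zx0 => {y z} [y _ _ k _|y z k yk yz IH zx0].
  by rewrite subrr rcoef0.
have pos j : 0 <= rcoef (z - refl k y) j by apply: ascends_coef.
have E j : rcoef (z - y) j =
    rcoef (z - refl k y) j - dot (beta k) y * (k == j)%:R.
  by rewrite reflE// !rcoefB rcoefZ rcoef_beta//; ring.
rewrite E; have [<-|km] := eqVneq k m.
  by have := pos k; rewrite mulr1 => ? ? j; exfalso; lra.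
rewrite mulr0 subr0 => zm; have zero := IH zx0 zm.
move=> j mj; rewrite E zero//.
have [kj|] := eqVneq k j; last by rewrite mulr0 subr0.
have mk : (m < k)%N by rewrite kj.
suff : dot (beta k) (refl k y) = 0.
  by rewrite dot_refl_self// => /eqP; rewrite oppr_eq0 => /eqP ->; rewrite mul0r subr0.
have -> : dot (beta k) (refl k y) = dot (beta k) z - dot (beta k) (z - refl k y).
  by rewrite dotBr; ring.
have -> : dot (beta k) z = 0.
  apply/eqP; rewrite eq_le leNgt zx0 x0_first x0_dominant andbT.
  by rewrite gtn_eqF// (leq_ltn_trans _ mk).
rewrite [dot _ (z - _)](dot_coef beta_free) big1 ?subr0// => i _.
have [mi|im|/val_inj <-] := ltngtP m i; first by rewrite zero// mul0r.
  by rewrite dotC chain_orthogonal ?mulr0// (leq_ltn_trans im).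
by rewrite zm mul0r.
Qed.

(** The property of [chain_vertex] passes to convex combinations: coordinates
    being nonnegative, a vanishing combination vanishes termwise. *)
Lemma chain_face (m : 'I_n) x : P x -> rcoef (x0 - x) m = 0 ->
  forall k : 'I_n, (m < k)%N -> rcoef (x0 - x) k = 0.
Proof.
move=> Px; move: x Px.
pose Q x := [/\ 0 <= rcoef (x0 - x) m & rcoef (x0 - x) m = 0 ->
  forall k : 'I_n, (m < k)%N -> rcoef (x0 - x) k = 0].
suff QP x : P x -> Q x by move=> x /QP[].
move: x; apply: hull_ind => [s|x y t /andP[t0 t1] [x_ge0 Qx] [y_ge0 Qy]].
  split; last by apply: chain_vertex => //; apply: dominant_ascends.
  by apply: hull_coef_ge0; apply: vertex_in.
rewrite /Q rcoef_conv; split=> [|xy0 k mk]; first by nra.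
have t1' : 0 < 1 - t by rewrite subr_gt0.
move/eqP: xy0; rewrite paddr_eq0 ?mulr_ge0 ?(ltW t0) ?(ltW t1')// !mulf_eq0.
rewrite (gt_eqF t0) (gt_eqF t1') /= => /andP[/eqP xm /eqP ym].
by rewrite rcoef_conv (Qx xm _ mk) (Qy ym _ mk) !mulr0 addr0.
Qed.

Lemma growing_initial m : (m <= n)%N -> exists2 s, growing s &
  size s = m /\ forall k : 'I_n, (k \in s) = (k < m)%N.
Proof.
elim: m => [_|m IH mn].
  by exists [::]; [apply: growing0|split=> // k; rewrite ltn0].
have [s gs [sm sE]] := IH (ltnW mn); exists (rcons s (Ordinal mn)).
  apply: growingS => //; first by rewrite sE ltnn.
  case: m mn {IH sm} sE => [|m] mn sE; [left|right].
    by rewrite x0_first.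
  have mn' := ltnW mn; exists (Ordinal mn'); first by rewrite sE /=.
  by rewrite dotC beta_chain.
split=> [|k]; first by rewrite size_rcons sm.
by rewrite mem_rcons inE sE ltnS [RHS]leq_eqVlt.
Qed.

Lemma initial_dim m : (m <= n)%N ->
  has_dim (std_face (fun k : 'I_n => (k < m)%N)) m.
Proof.
move=> /growing_initial[s gs [sm sE]].
rewrite -{2}sm -(eq_std_face (I := mem s)) => [|k]; last exact: sE.
exact: growing_dim.
Qed.

(** Conjugate the functional defining F into the dominant chamber, let m be the
    first node on which it is positive, or n, and compare dimensions. *)
Lemma face_conjugate F d : (d < n)%N -> face P F -> has_dim F d ->
  exists s, F = word s @` std_face (fun k : 'I_n => (k < d)%N).
Proof.
move=> dn [c [b [Pb FE]]] Fd.
have [s cd] := ex_word_dominant beta_free beta_norm W_finite c.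
have bE : dot (word s c) x0 = b.
  have [p [M [_]]] := Fd; rewrite FE => -[Pp /= cp] _ _; apply/eqP.
  rewrite eq_le dot_wordl// Pb ?andTb; last exact: vertex_in.
  rewrite -dot_wordl// -cp -(dot_word beta_norm s c p).
  by apply: dominant_le => //; apply: hull_word.
pose I (k : 'I_n) := dot (beta k) (word s c) == 0.
have Fim : F = word (rev s) @` std_face I.
  rewrite -dominant_face// FE; apply/seteqP; split=> [x [Px /= cx]|].
    exists (word s x); last by rewrite wordK.
    by split=> /=; [apply: hull_word|rewrite dot_word// cx].
  move=> _ [x [Px /= cx] <-]; split=> /=; first exact: hull_word.
  by rewrite -dot_wordl// cx.
have exm : exists m, (m == n) || [exists k : 'I_n, (k == m :> nat) && ~~ I k].
  by exists n; rewrite eqxx.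
have [m mP mmin] := ex_minnP exm.
have mn : (m <= n)%N.
  by case/orP: mP => [/eqP->//|/existsP[k /andP[/eqP <- _]]]; apply: ltnW.
have IE : std_face I = std_face (fun k : 'I_n => (k < m)%N).
  apply/seteqP; split=> x [Px /= xI]; split=> //= k.
    rewrite -leqNgt => mk; case/orP: mP => [/eqP mE|].
      by move: (leq_ltn_trans mk (ltn_ord k)); rewrite mE ltnn.
    case/existsP=> j /andP[/eqP jm jI].
    have [jk|kj|/val_inj <-] := ltngtP j k; last exact: xI.
      by apply: (chain_face Px _ jk); apply: xI.
    by move: mk; rewrite -jm leqNgt kj.
  move=> kI; apply: xI; rewrite -leqNgt; apply: mmin; apply/orP; right.
  by apply/existsP; exists k; rewrite eqxx.
have <- : m = d.
  apply: (has_dim_unique (F := F)) => //; rewrite Fim IE.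
  by apply: has_dim_word => //; apply: initial_dim.
by exists (rev s); rewrite Fim IE.
Qed.

Lemma chain_platonic : platonic W P.
Proof.
move=> d dn F F' Fface Fd F'face F'd.
have [s ->] := face_conjugate dn Fface Fd.
have [s' ->] := face_conjugate dn F'face F'd.
exists (word (s' ++ rev s)); first by exists (s' ++ rev s).
apply/seteqP; split=> [_ [x xI <-]|_ [_ [x xI <-] <-]].
  by exists (word s x); [exists x|rewrite word_cat wordK].
by exists x => //; rewrite word_cat wordK.
Qed.
End Chain.
End Polytope.

(** * The numbers 2 cos (pi / m) *)
Section Angles.
Variable R : realType.

Definition link (m : nat) : R := 2 * cos (pi / m%:R).

Lemma link_gt0 m : (2 < m)%N -> 0 < link m.
Proof.
move=> m2; rewrite mulr_gt0// cos_gt0_pihalf//; have pi0 := @pi_gt0 R.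
have mR : 2 < m%:R :> R by rewrite ltr_nat.
apply/andP; split; last by rewrite ltr_pM2l// ltf_pV2 ?posrE//; lra.
by apply: (@lt_trans _ _ 0); rewrite ?oppr_lt0 divr_gt0//; lra.
Qed.

Lemma cos_pi_sub (x : R) : cos (pi - x) = - cos x.
Proof. by rewrite addrC cosDpi cosN. Qed.

Lemma link2 : link 2 = 0.
Proof. by rewrite /link cos_pihalf mulr0. Qed.

(** From cos (2 x) = - cos x for x = pi / 3, discarding the root -1. *)
Lemma link3 : link 3 = 1.
Proof.
have := cos_pi_sub (pi / 3); have -> : pi - pi / 3 = (pi / 3) *+ 2 :> R by lra.
have := @link_gt0 3 isT; rewrite /link cos_mulr2n; nra.
Qed.

Lemma link4 : link 4 ^+ 2 = 2.
Proof.
have := @cos_pihalf R; have -> : pi / 2 = (pi / 4) *+ 2 :> R by lra.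
rewrite /link cos_mulr2n; nra.
Qed.

(** From cos (3 x) = - cos (2 x) for x = pi / 5, whose roots in cos x are -1 and
    those of the minimal polynomial. *)
Lemma link5 : link 5 ^+ 2 = link 5 + 1.
Proof.
have := cos_pi_sub ((pi / 5) *+ 2).
have -> : pi - (pi / 5) *+ 2 = (pi / 5) *+ 2 + pi / 5 :> R by lra.
rewrite cosD sin_mulr2n cos_mulr2n => cos3.
have := @link_gt0 5 isT; have := sin2cos2 (pi / 5 : R).
rewrite /link; move: (cos _) (sin _) cos3 => c s cos3 s2 c0.
have /eqP : (c + 1) * (4 * c ^+ 2 - 2 * c - 1) = 0.
  have -> : (c + 1) * (4 * c ^+ 2 - 2 * c - 1) = (c ^+ 2 *+ 2 - 1) * c -
    (c * s) *+ 2 * s + (c ^+ 2 *+ 2 - 1) by ring: s2.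
  by rewrite cos3; ring.
rewrite mulf_eq0 => /orP[/eqP|/eqP]; lra.
Qed.

Lemma link_coxeter m : (2 <= m <= 5)%N -> coxeter_link (link m).
Proof.
case: m => [|[|[|[|[|[|m]]]]]]// _.
- by constructor 1; apply: link2.
- by constructor 2; apply: link3.
- by constructor 3; split; [apply: link_gt0|apply: link4].
- by constructor 4; split; [apply: link_gt0|apply: link5].
Qed.
End Angles.

(** * Normalised simple roots *)
Section Rescaling.
Variables (R : realType) (n : nat).
Implicit Types (alpha : 'I_n -> 'rV[R]_n) (a : 'I_n -> R).

(** A reflection depends on the line spanned by its root alone. *)
Lemma reflection_scale a alpha : (forall k, a k != 0) ->
  reflection (fun k => a k *: alpha k) = reflection alpha.
Proof.
move=> a0; apply/funext => k; apply/funext => x.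
rewrite /reflection !dotr scalerA; congr (x - _ *: _).
have [d0|d0] := eqVneq (dot (alpha k) (alpha k)) 0.
  by rewrite d0 !mulr0 invr0 !mulr0 mul0r.
by field; rewrite d0 a0.
Qed.

Lemma row_free_scale a alpha : (forall k, a k != 0) ->
  row_free (\matrix_(i < n) alpha i) ->
  row_free (\matrix_(i < n) (a i *: alpha i)).
Proof.
move=> a0 fr; apply: inj_row_free => v va; apply/rowP => k; rewrite mxE.
suff : (\row_i (v 0 i * a i)) *m (\matrix_i alpha i) = 0.
  rewrite -(mul0mx _ (\matrix_i alpha i)) => /(row_free_inj fr) /rowP /(_ k) /eqP.
  by rewrite !mxE mulf_eq0 (negPf (a0 k)) orbF => /eqP.
rewrite -va !mulmx_sum_row; apply: eq_bigr => i _.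
by rewrite !rowK mxE scalerA.
Qed.
End Rescaling.

Section NormalizedRoots.
Variables (R : realType) (n : nat) (X : diagram_family).
Variable alpha : 'I_n -> 'rV[R]_n.
Hypothesis n_ge3 : (3 <= n)%N.
Hypothesis Xn : is_diagram X n.
Hypothesis alpha_simple : simple_roots X alpha.

Let len k : R := Num.sqrt (dot (alpha k) (alpha k)).
Let scale k := Num.sqrt 2 / len k.

Definition unit_root k : 'rV[R]_n := scale k *: alpha k.

Lemma len_gt0 k : 0 < len k.
Proof.
have [fr _ _] := alpha_simple.
by rewrite sqrtr_gt0; apply: dot_gt0; apply: beta_neq0 fr k.
Qed.

Lemma scale_gt0 k : 0 < scale k.
Proof. by rewrite divr_gt0 ?len_gt0// sqrtr_gt0. Qed.

Lemma scale_neq0 k : scale k != 0.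
Proof. by rewrite gt_eqF// scale_gt0. Qed.

Lemma unit_root_free : row_free (\matrix_(i < n) unit_root i).
Proof. by apply: row_free_scale scale_neq0 _; have [] := alpha_simple. Qed.

Lemma unit_root_norm k : dot (unit_root k) (unit_root k) = 2.
Proof.
rewrite /unit_root !dotr /scale -(sqr_sqrtr (ltW (dot_gt0 _))).
  rewrite -/(len k); have := len_gt0 k => l0.
  have -> : Num.sqrt 2 / len k * (Num.sqrt 2 / len k * len k ^+ 2) =
    Num.sqrt 2 ^+ 2 by field; rewrite gt_eqF.
  by rewrite sqr_sqrtr.
by have [fr _ _] := alpha_simple; apply: beta_neq0 fr k.
Qed.

Lemma unit_root_angle (i j : 'I_n) : (i < j)%N ->
  dot (unit_root i) (unit_root j) = - link R (bond X n i j).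
Proof.
move=> ij; have [_ angle _] := alpha_simple.
rewrite /unit_root !dotr angle// -/(len i) -/(len j) /scale /link.
have := len_gt0 i; have := len_gt0 j => lj li.
have s2 : Num.sqrt 2 ^+ 2 = 2 :> R by rewrite sqr_sqrtr.
by field: s2; rewrite !gt_eqF.
Qed.

Lemma bond_range (i j : nat) : (2 <= bond X n i j <= 5)%N.
Proof.
by case: X Xn => //=; try (by move=> _; repeat case: ifP); lia.
Qed.

Lemma unit_root_link i j : i != j ->
  coxeter_link (- dot (unit_root i) (unit_root j)).
Proof.
wlog ij : i j / (i < j)%N => [wl ij|_].
  have [lij|lji|/val_inj eij] := ltngtP i j; first exact: wl.
    by rewrite dotC; apply: wl => //; rewrite eq_sym.
  by rewrite eij eqxx in ij.
by rewrite unit_root_angle// opprK; apply: link_coxeter; apply: bond_range.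
Qed.

Lemma unit_root_group : reflection_group unit_root = reflection_group alpha.
Proof.
by rewrite /reflection_group (reflection_scale _ scale_neq0).
Qed.

Lemma unit_root_dominant x : dominant alpha x -> dominant unit_root x.
Proof.
by move=> xd k; rewrite /unit_root dotZl mulr_ge0// ltW// scale_gt0.
Qed.

End NormalizedRoots.

Lemma fork_diagram (X : diagram_family) n :
  (X = FamD /\ (4 <= n)%N) \/ (X = FamE /\ (6 <= n)%N) ->
  exists2 a, (0 < a < n - 2)%N & forall i j, (i < j)%N ->
    (if j == n.-1 then i == a else j == i.+1) -> bond X n i j = 3.
Proof.
case=> -[-> n4]; [exists (n - 3)%N|exists 2]; rewrite ?ltnS; try lia.
  by move=> i j ij /= ->.
by move=> i j ij /= ->.
Qed.

Lemma fork_gives_no_platonic (R : realType) n X : (3 <= n)%N -> is_diagram X n ->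
  (X = FamD /\ (4 <= n)%N) \/ (X = FamE /\ (6 <= n)%N) -> ~ gives_platonic R n X.
Proof.
move=> n3 Xn Xfork [alpha [alphaP Wfin [x0 [x0n0 x0d plat]]]].
have [a an aE] := fork_diagram Xfork.
have := @fork_not_platonic R n (unit_root alpha) (unit_root_free alphaP)
  (unit_root_norm alphaP) (unit_root_link n3 Xn alphaP).
rewrite (unit_root_group alphaP) => /(_ Wfin x0 (unit_root_dominant alphaP x0d)).
move=> /(_ a an); apply=> // i j ij ijE.
by rewrite (unit_root_angle alphaP)// aE// link3 oppr_lt0.
Qed.

(** * A criterion for finiteness *)
Section FiniteGroup.
Variables (R : realType) (n : nat) (beta : 'I_n -> 'rV[R]_n).
Hypothesis beta_free : row_free (\matrix_(i < n) beta i).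
Hypothesis beta_norm : forall k, dot (beta k) (beta k) = 2.

Variable S : seq 'rV[R]_n.
Hypothesis S_stable : forall v k, v \in S -> reflection beta k v \in S.
Hypothesis S_generic : forall k, exists2 v, v \in S & dot (beta k) v != 0.

(** If v is not orthogonal to beta_k then beta_k is proportional to v - r_k v,
    so that S spans. *)
Lemma word_determined s t :
  (forall v, v \in S -> word beta s v = word beta t v) -> word beta s = word beta t.
Proof.
move=> st; have beta_eq k : word beta s (beta k) = word beta t (beta k).
  have [v vS kv] := S_generic k; apply: (scalerI kv); rewrite -!wordZ//.
  have -> : dot (beta k) v *: beta k = v - reflection beta k v.
    by rewrite reflE// opprB addrC subrK.
  by rewrite (wordB _ s)// (wordB _ t)// (st v vS) (st _ (S_stable k vS)).
apply/funext => x; rewrite -[x](mulmxKV (beta_unit beta_free)) !word_mulmx//.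
by congr (_ *m _); apply/row_matrixP => k; rewrite !rowK.
Qed.

Lemma finite_reflection_group : finite_set (reflection_group beta).
Proof.
pose agree (f : {ffun seq_sub S -> seq_sub S}) w :=
  reflection_group beta w /\ forall v : seq_sub S, w (val v) = val (f v).
have /boolp.choice[rep repP] : forall f, exists w, (exists w', agree f w') ->
    agree f w.
  move=> f; have [[w fw]|none] := pselect (exists w, agree f w); first by exists w.
  by exists idfun.
apply: (@sub_finite_set _ _ (rep @` setT)); last exact/finite_image/finite_finset.
move=> _ [s ->]; rewrite -/(word beta s).
have sS v : v \in S -> word beta s v \in S.
  by elim: s => //= k s IH vS; apply/S_stable/IH.
pose f := [ffun v : seq_sub S => SeqSub (sS _ (valP v))].
have [[t tE] fE] : agree f (rep f).
  apply: repP; exists (word beta s); split; first by exists s.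
  by move=> v; rewrite ffunE.
exists f => //; rewrite tE -/(word beta t); apply: word_determined => v vS.
by rewrite -[v]/(val (SeqSub vS)) /word -tE fE ffunE.
Qed.
End FiniteGroup.

(** * Realising the roots of a chain *)
Section Chains.
Variables (R : realType) (n : nat).
Implicit Type t : nat -> R.

(** The Gram matrix of a chain in which the link between the nodes i-1 and i has
    weight t i. *)
Definition chain_gram t (i j : nat) : R :=
  2 * (i == j)%:R - t j * (i.+1 == j)%:R - t i * (j.+1 == i)%:R.

(** The pivots of the Gaussian elimination of [chain_gram]: the matrix is
    positive definite when they are positive. *)
Fixpoint pivot t i : R :=
  if i is j.+1 then 2 - t i ^+ 2 / pivot t j else 2.

Let e (m : nat) : 'rV[R]_n := \row_j (j == m :> nat)%:R.

Let dot_e a b : (a < n)%N -> dot (e a) (e b) = (a == b)%:R.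
Proof.
move=> an; rewrite dotE (bigD1 (Ordinal an))//= big1 => [|i ia].
  by rewrite !mxE /= eqxx mul1r addr0.
rewrite !mxE (_ : (i == a :> nat) = false) ?mul0r//.
by apply: contraNF ia => /eqP ia; apply/eqP/val_inj.
Qed.

(** The Cholesky factor of a tridiagonal matrix is bidiagonal: beta_i is a
    combination of the coordinate vectors of index i and i-1. *)
Lemma ex_chain t : (forall i, (i < n)%N -> 0 < pivot t i) ->
  exists2 beta : 'I_n -> 'rV[R]_n, row_free (\matrix_(i < n) beta i) &
    forall i j : 'I_n, dot (beta i) (beta j) = chain_gram t i j.
Proof.
move=> d_gt0; pose s i := Num.sqrt (pivot t i).
have s_gt0 i : (i < n)%N -> 0 < s i by move=> /d_gt0; rewrite sqrtr_gt0.
pose u i := if i is j.+1 then t i / s j else 0.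
pose beta (i : 'I_n) := s i *: e i - u i *: e i.-1.
have diag i : (i < n)%N -> s i ^+ 2 + u i ^+ 2 = 2.
  case: i => [|i] ni; rewrite /u /s ?expr0n ?addr0.
    by rewrite sqr_sqrtr// ltW// d_gt0.
  have /ltW p0 := d_gt0 i (ltnW ni); have /ltW p1 := d_gt0 _ ni.
  by rewrite expr_div_n !sqr_sqrtr//= subrK.
exists beta.
  rewrite row_free_unit unitmxE det_trig; last first.
    apply/is_trig_mxP => i j ij; rewrite !mxE.
    by rewrite !gtn_eqF ?mulr0 ?subrr//; lia.
  rewrite unitfE; apply/prodf_neq0 => i _; rewrite !mxE eqxx mulr1.
  case: i => -[|i] ni /=; first by rewrite mul0r subr0 gt_eqF// s_gt0.
  by rewrite gtn_eqF// mulr0 subr0 gt_eqF// s_gt0.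
move=> i j; wlog ij : i j / (i <= j)%N => [wl|].
  have [/wl//|/ltnW/wl] := leqP i j; rewrite dotC => ->.
  by rewrite /chain_gram eq_sym; ring.
have ni := ltn_ord i; have nj := ltn_ord j.
rewrite /beta !dotr !dot_e; try lia; rewrite /chain_gram.
have -> : (j.+1 == i :> nat) = false by lia.
have [eij|nij] := eqVneq (i : nat) j.
  rewrite eij eqxx; have -> : (j.+1 == j :> nat) = false by lia.
  rewrite -(diag _ nj); case: (j : nat) => [|k] /=; first by rewrite /u; ring.
  by rewrite (gtn_eqF (ltnSn k)) (ltn_eqF (ltnSn k)) !mulr0; ring.
have -> : (i.-1 == j :> nat) = false by lia.
case: (j : nat) ij nij nj => [|k] /= ik nik nk; first by lia.
rewrite eqSS; have [->|ik'] := eqVneq (i : nat) k.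
  have sk0 : s k != 0 by rewrite gt_eqF// s_gt0// ltnW.
  case: k {ik nik nk} sk0 => [|k] sk0 /=; first by rewrite /u; field.
  by rewrite (ltn_eqF (ltnSn k)) !(mulr0, oppr0); field.
have -> : (i.-1 == k) = false by lia.
by rewrite !mulr0; ring.
Qed.
End Chains.

(** * Finiteness of the groups of type A, B and C *)

(** Decides all equalities between natural numbers that occur in the goal. *)
Ltac split_nat_eqs :=
  repeat match goal with
  | |- context [@eq_op _ ?a ?b] => case: (@eqVneq _ a b) => ?; try (exfalso; lia)
  end; rewrite /= ?(mulr0, mulr1, subr0, addr0).

Section ClassicalFinite.
Variables (R : realType) (n : nat) (t : nat -> R) (beta : 'I_n -> 'rV[R]_n).
Hypothesis beta_free : row_free (\matrix_(i < n) beta i).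
Hypothesis beta_gram : forall i j : 'I_n, dot (beta i) (beta j) = chain_gram t i j.

Lemma chain_norm k : dot (beta k) (beta k) = 2.
Proof. by rewrite beta_gram /chain_gram eqxx (gtn_eqF (ltnSn k)) !mulr0 !subr0 mulr1. Qed.

(** The action of a reflection in the coordinates of the fundamental weights. *)
Lemma reflection_dual k (f g : 'I_n -> R) :
  (forall j : 'I_n, f j - f k * chain_gram t k j = g j) ->
  reflection beta k (dual_vec beta f) = dual_vec beta g.
Proof.
move=> fg; apply: (eq_dot beta_free) => j; rewrite (reflE chain_norm) !dotr.
by rewrite !dot_dual// -fg beta_gram /chain_gram eq_sym; ring.
Qed.

(** The orbit of the first fundamental weight: the n + 1 vertices v_0, ..., v_n
    of a simplex, with v_m - v_(m+1) = beta_m, where r_k exchanges v_k and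
    v_(k+1). *)
Lemma type_A_finite : (forall i, (0 < i < n)%N -> t i = 1) ->
  finite_set (reflection_group beta).
Proof.
move=> t1; have gramE (k j : 'I_n) : chain_gram t k j =
    2 * (k == j :> nat)%:R - (k.+1 == j)%:R - (j.+1 == k)%:R.
  rewrite /chain_gram; have kn := ltn_ord k; have jn := ltn_ord j.
  have [kj|_] := eqVneq k.+1 j; have [jk|_] := eqVneq j.+1 k;
    rewrite ?(mulr0, mulr1)//; rewrite ?t1; by [|lia].
pose f (m : nat) (j : 'I_n) : R := (j == m :> nat)%:R - (j.+1 == m)%:R.
pose S := [seq dual_vec beta (f m) | m <- iota 0 n.+1].
have fS m : (m <= n)%N -> dual_vec beta (f m) \in S.
  by move=> mn; apply/mapP; exists m; rewrite // mem_iota.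
apply: (finite_reflection_group beta_free chain_norm (S := S)) => [v k|k].
  move=> /mapP[m]; rewrite mem_iota /= add0n ltnS => mn ->; have kn := ltn_ord k.
  have move_to m' : (m' <= n)%N ->
      (forall j, f m j - f m k * chain_gram t k j = f m' j) ->
      reflection beta k (dual_vec beta (f m)) \in S.
    by move=> m'n E; rewrite (reflection_dual E) fS.
  have [km|km] := eqVneq (k : nat) m; [apply: (move_to m.+1); first by lia|].
    by move=> j; rewrite gramE /f; split_nat_eqs; ring.
  have [k1m|k1m] := eqVneq k.+1 m; [apply: (move_to m.-1); first by lia|].
    by move=> j; rewrite gramE /f; split_nat_eqs; ring.
  by apply: (move_to m) => // j; rewrite gramE /f; split_nat_eqs; ring.
exists (dual_vec beta (f k)); first by apply: fS; apply: ltnW.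
by rewrite dot_dual// /f eqxx (gtn_eqF (ltnSn k)) subr0 oner_neq0.
Qed.

(** The orbit of the first fundamental weight: the 2 n vertices of a cross
    polytope.  As above r_k exchanges two neighbours for k < n-1, while the last
    reflection negates v_(n-1), which is proportional to the last root. *)
Lemma type_BC_finite : (2 <= n)%N -> (forall i, (0 < i < n.-1)%N -> t i = 1) ->
  t n.-1 ^+ 2 = 2 -> finite_set (reflection_group beta).
Proof.
move=> n2 t1 tn; pose T := t n.-1; have T2 : T ^+ 2 = 2 := tn.
pose last i : R := (i == n.-1)%:R.
have gramE (k j : 'I_n) : chain_gram t k j = 2 * (k == j :> nat)%:R
    - (1 + (T - 1) * last j) * (k.+1 == j)%:R
    - (1 + (T - 1) * last k) * (j.+1 == k)%:R.
  rewrite /chain_gram /last; have kn := ltn_ord k; have jn := ltn_ord j.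
  have tE (i : nat) : (0 < i < n)%N -> t i = 1 + (T - 1) * (i == n.-1)%:R.
    move=> i0; have [->|i1] := eqVneq i n.-1; first by rewrite mulr1 /T; ring.
    by rewrite mulr0 addr0 t1//; lia.
  have [kj|_] := eqVneq k.+1 j; have [jk|_] := eqVneq j.+1 k;
    rewrite ?(mulr0, mulr1)//; rewrite ?tE; by [|lia].
pose f (s : bool) (m : nat) (j : 'I_n) : R := (-1) ^+ s *
  ((1 + (T - 1) * last j) * (j == m :> nat)%:R - (j.+1 == m)%:R).
pose S := [seq dual_vec beta (f s m) | s <- [:: true; false], m <- iota 0 n].
have fS s m : (m < n)%N -> dual_vec beta (f s m) \in S.
  move=> mn; apply/allpairsP; exists (s, m); rewrite mem_iota mn.
  by case: s.
apply: (finite_reflection_group beta_free chain_norm (S := S)) => [v k|k].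
  move=> /allpairsP[[s m] /= []]; rewrite mem_iota /= add0n => _ mn ->.
  have kn := ltn_ord k.
  have move_to s' m' : (m' < n)%N ->
      (forall j, f s m j - f s m k * chain_gram t k j = f s' m' j) ->
      reflection beta k (dual_vec beta (f s m)) \in S.
    by move=> m'n E; rewrite (reflection_dual E) fS.
  have [km|km] := eqVneq (k : nat) m.
    have [kn1|kn1] := eqVneq (k : nat) n.-1.
      apply: (move_to (~~ s) m) => // j; have jn := ltn_ord j.
      by rewrite gramE /f /last; case: s {move_to};
        rewrite ?expr0 ?expr1; split_nat_eqs; ring: T2.
    apply: (move_to s m.+1) => [|j]; first by lia.
    have jn := ltn_ord j.
    by rewrite gramE /f /last; split_nat_eqs; ring.
  have [k1m|k1m] := eqVneq k.+1 m; [apply: (move_to s m.-1); first by lia|].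
    move=> j; have jn := ltn_ord j.
    by rewrite gramE /f /last; split_nat_eqs; ring.
  apply: (move_to s m) => // j.
  by rewrite gramE /f /last; split_nat_eqs; ring.
exists (dual_vec beta (f false k)); first exact: fS.
rewrite dot_dual// /f eqxx (gtn_eqF (ltnSn k)) subr0 expr0 mul1r mulr1 /last.
have [_|_] := eqVneq (k : nat) n.-1; last by rewrite mulr0 addr0 oner_neq0.
by rewrite mulr1 addrC subrK; apply: contra_eqN T2 => /eqP ->; rewrite expr0n eq_sym pnatr_eq0.
Qed.
End ClassicalFinite.

(** * Finiteness of the groups of type F and H, by computation *)

(** Root systems over Z[T], where T ^ 2 = p + q T is the weight of the link
    between the nodes special-1 and special, all other links having weight 1.  A
    root is the list of its coordinates in the simple roots. *)
Section RootClosure.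
Variables (p q : int) (special n : nat).

(** The pair (a, b) stands for a + b T. *)
Definition quad : Type := (int * int)%type.

Definition quad_scale (z : quad) : quad := (p * z.2, z.1 + q * z.2).

Definition weight_act (i : nat) (z : quad) : quad :=
  if i == special then quad_scale z else z.

Definition list_reflection (k : nat) (z : seq quad) : seq quad :=
  let at_ i := nth (0, 0) z i in
  let l := if k is k'.+1 then weight_act k (at_ k') else (0, 0) in
  let r := weight_act k.+1 (at_ k.+1) in
  set_nth (0, 0) z k (l.1 + r.1 - (at_ k).1, l.2 + r.2 - (at_ k).2).

Definition list_simple (i : nat) : seq quad :=
  mkseq (fun j => ((j == i)%:Z, 0)) n.

(** Breadth-first closure under the simple reflections. *)
Fixpoint explore (fuel : nat) (seen frontier : seq (seq quad)) :=
  if fuel is f.+1 then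
    let new := undup [seq z <- [seq list_reflection k z | z <- frontier, k <- iota 0 n]
                     | z \notin seen] in
    explore f (seen ++ new) new
  else seen.

(** The fuel 40 is enough to exhaust the root systems of F_4, H_3 and H_4. *)
Definition list_roots : seq (seq quad) :=
  let simple := [seq list_simple i | i <- iota 0 n] in explore 40 simple simple.

Definition stable_roots (r : seq (seq quad)) : bool :=
  all (fun i => list_simple i \in r) (iota 0 n) &&
  all (fun z => (size z == n) &&
         all (fun k => list_reflection k z \in r) (iota 0 n)) r.
End RootClosure.

Section ComputedRoots.
Variables (R : realType) (n : nat) (t : nat -> R) (beta : 'I_n -> 'rV[R]_n).
Hypothesis beta_free : row_free (\matrix_(i < n) beta i).
Hypothesis beta_gram : forall i j : 'I_n, dot (beta i) (beta j) = chain_gram t i j.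
Variables (p q : int) (special : nat).
Hypothesis t_special : t special ^+ 2 = p%:~R + q%:~R * t special.
Hypothesis t_plain : forall i, (0 < i < n)%N -> i != special -> t i = 1.

Let eval (z : quad) : R := z.1%:~R + z.2%:~R * t special.

Let list_vec (z : seq quad) : 'rV[R]_n :=
  \sum_(k < n) eval (nth (0, 0) z k) *: beta k.

Let eval0 : eval (0, 0) = 0.
Proof. by rewrite /eval mul0r addr0. Qed.

Let eval_act i z : (0 < i < n)%N -> eval (weight_act p q special i z) = t i * eval z.
Proof.
move=> i0; rewrite /weight_act /eval; have [->|is_] := eqVneq i special => /=.
  by rewrite rmorphD !rmorphM /=; ring: t_special.
by rewrite (t_plain i0 is_) mul1r.
Qed.

Let sum_delta (F : nat -> R) (m : nat) :
  \sum_(j < n) F j * (m == j)%:R = if (m < n)%N then F m else 0.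
Proof.
case: ltnP => [mn|nm]; last first.
  by rewrite big1// => j _; rewrite gtn_eqF ?mulr0// (leq_trans (ltn_ord j)).
rewrite (bigD1 (Ordinal mn))//= eqxx mulr1 big1 ?addr0// => j jm.
rewrite (_ : (m == j) = false) ?mulr0//.
by apply: contraNF jm => /eqP mj; apply/eqP/val_inj.
Qed.

(** The computation on lists mirrors the geometric reflection.  Reading beyond
    the end of a list yields 0, which accounts for the missing right neighbour
    of the last node. *)
Let list_vec_reflection (k : 'I_n) z : size z = n ->
  reflection beta k (list_vec z) = list_vec (list_reflection p q special k z).
Proof.
move=> zn; pose y i := eval (nth (0, 0) z i).
have ktn := ltn_ord k.
pose l := if (k : nat) is k'.+1 then t k * y k' else 0.
pose r := if (k.+1 < n)%N then t k.+1 * y k.+1 else 0.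
have yout i : (n <= i)%N -> y i = 0 by move=> ni; rewrite /y nth_default ?zn.
have dotE : dot (beta k) (list_vec z) = 2 * y k - r - l.
  rewrite dot_sumr; under eq_bigr => j _ do
    rewrite dotZr beta_gram /chain_gram -/(y j) !mulrBr.
  rewrite !sumrB; congr (_ - _ - _).
  - under eq_bigr => j _ do rewrite mulrA.
    by rewrite (sum_delta (fun j => y j * 2)) ltn_ord mulrC.
  - under eq_bigr => j _ do rewrite mulrA.
    by rewrite (sum_delta (fun j => y j * t j)) /r; case: ifP => // _; rewrite mulrC.
  - rewrite /l; case: (k : nat) ktn => [|k'] kn.
      by rewrite big1// => j _; rewrite !mulr0.
    under eq_bigr => j _ do rewrite eqSS eq_sym mulrA.
    by rewrite (sum_delta (fun j => y j * t k'.+1)) (ltnW kn) mulrC.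
have listE j : eval (nth (0, 0) (list_reflection p q special k z) j) =
    if j == k then l + r - y k else y j.
  rewrite /list_reflection nth_set_nth /=; case: eqP => // _.
  set L := if (k : nat) is _.+1 then _ else _; set Rr := weight_act _ _ _ k.+1 _.
  have -> : l = eval L.
    rewrite /l /L; case: (k : nat) ktn => [|k'] kn; first by rewrite eval0.
    by rewrite eval_act.
  have -> : r = eval Rr.
    rewrite /r /Rr; case: ltnP => kn; first by rewrite eval_act.
    rewrite nth_default ?zn// /weight_act /quad_scale /=.
    by case: ifP; rewrite ?mulr0 ?addr0 eval0.
  by rewrite /y /eval /= !rmorphB !rmorphD /=; ring.
rewrite (reflE (chain_norm beta_gram)) dotE /list_vec (bigD1 k)//= [RHS](bigD1 k)//=.
rewrite listE eqxx -/(y k) addrAC -scalerBl; congr (_ *: _ + _); first by ring.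
apply: eq_bigr => j jk; rewrite listE ifF//.
by apply: contraNF jk => /eqP jk; apply/eqP/val_inj.
Qed.

Let list_vec_simple (i : 'I_n) : list_vec (list_simple n i) = beta i.
Proof.
rewrite /list_vec (bigD1 i)//= big1 => [|j ji].
  by rewrite nth_mkseq// eqxx /eval /= mul0r !addr0 scale1r.
rewrite nth_mkseq// (_ : (j == i :> nat) = false) ?eval0 ?scale0r//.
by apply: contraNF ji => /eqP ji; apply/eqP/val_inj.
Qed.

Lemma computed_finite r : stable_roots p q special n r ->
  finite_set (reflection_group beta).
Proof.
move=> /andP[/allP simple_r /allP stable_r].
apply: (finite_reflection_group beta_free (chain_norm beta_gram)
  (S := [seq list_vec z | z <- r])) => [_ k /mapP[z zr ->]|k].
  have /andP[/eqP zn /allP zk] := stable_r z zr.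
  by rewrite list_vec_reflection// map_f// zk// mem_iota ltn_ord.
exists (list_vec (list_simple n k)).
  by rewrite map_f// simple_r// mem_iota ltn_ord.
by rewrite list_vec_simple (chain_norm beta_gram) pnatr_eq0.
Qed.
End ComputedRoots.

(** * Platonic solids from chains *)
Section ChainDiagrams.
Variables (R : realType) (n : nat) (X : diagram_family).
Hypothesis n_ge3 : (3 <= n)%N.
Hypothesis Xn : is_diagram X n.

Definition chain_family : bool :=
  match X with FamA | FamB | FamC | FamF | FamH => true | _ => false end.

Definition chain_weight (i : nat) : R := link R (bond X n i.-1 i).

Lemma chain_bond (i j : nat) : chain_family -> (i < j)%N ->
  if j == i.+1 then (2 < bond X n i j)%N else bond X n i j == 2.
Proof.
rewrite /chain_family; case: X Xn => //= _ _ ij;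
  by case: eqP => // _; repeat case: ifP.
Qed.

Lemma sqlen_gt0 i : (0 < sqlen X n i)%N.
Proof. by case: X => //=; case: ifP. Qed.

(** The simple roots are the vectors of [ex_chain] scaled to the lengths of the
    diagram, and the seed is the first fundamental weight. *)
Lemma chain_gives_platonic : chain_family ->
  (forall i, (i < n)%N -> 0 < pivot chain_weight i) ->
  (forall beta : 'I_n -> 'rV[R]_n, row_free (\matrix_(i < n) beta i) ->
     (forall i j : 'I_n, dot (beta i) (beta j) = chain_gram chain_weight i j) ->
     finite_set (reflection_group beta)) ->
  gives_platonic R n X.
Proof.
move=> Xchain piv fin.
have [beta bfree bgram] := ex_chain piv; have bfin := fin beta bfree bgram.
have bnorm := chain_norm bgram.
have bangle (i j : 'I_n) : (i < j)%N ->
    dot (beta i) (beta j) = - link R (bond X n i j).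
  move=> ij; rewrite bgram /chain_gram (ltn_eqF ij) (_ : j.+1 == i = false); last by lia.
  have := chain_bond Xchain ij; rewrite [(j : nat) == _]eq_sym /chain_weight.
  have [<-/= _|_ /eqP ->] := eqVneq i.+1 j; first by rewrite !mulr0; ring.
  by rewrite link2 !mulr0; ring.
have blink (i j : 'I_n) : i != j -> coxeter_link (- dot (beta i) (beta j)).
  wlog ij : i j / (i < j)%N => [wl ij|_].
    have [lij|lji|/val_inj eij] := ltngtP i j; first exact: wl.
      by rewrite dotC; apply: wl => //; rewrite eq_sym.
    by rewrite eij eqxx in ij.
  by rewrite bangle// opprK; apply: link_coxeter; apply: bond_range.
pose a (i : 'I_n) : R := Num.sqrt (sqlen X n i)%:R.
have a_gt0 i : 0 < a i by rewrite sqrtr_gt0 ltr0n sqlen_gt0.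
have a_neq0 i : a i != 0 by rewrite gt_eqF.
have a_sqr i : a i ^+ 2 = (sqlen X n i)%:R by rewrite sqr_sqrtr ?ler0n.
pose alpha i := a i *: beta i.
have groupE : reflection_group alpha = reflection_group beta.
  by rewrite /reflection_group (reflection_scale _ a_neq0).
have alpha_norm i : dot (alpha i) (alpha i) = a i ^+ 2 * 2.
  by rewrite /alpha !dotr bnorm; ring.
have sqrt_norm i : Num.sqrt (a i ^+ 2 * 2) = a i * Num.sqrt 2.
  by rewrite sqrtrM ?sqr_ge0// sqrtr_sqr gtr0_norm.
pose x0 := dual_vec beta (fun k => (k == 0%N :> nat)%:R).
have x0E k : dot (beta k) x0 = (k == 0%N :> nat)%:R by rewrite dot_dual.
exists alpha; split.
- split=> [|i j ij|i j].
  + exact: row_free_scale.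
  + rewrite !alpha_norm !sqrt_norm.
    rewrite /alpha !dotr bangle// /link.
    have s2 : Num.sqrt 2 ^+ 2 = 2 :> R by rewrite sqr_sqrtr.
    ring: s2.
  + by rewrite !alpha_norm !a_sqr; ring.
- by rewrite groupE.
have n0 : (0 < n)%N by lia.
exists x0; split.
- move=> x00; have := x0E (Ordinal n0).
  by rewrite x00 dot0r /= => /esym/eqP; rewrite oner_eq0.
- by move=> k; rewrite /alpha dotZl x0E mulr_ge0 ?ler0n// ltW.
rewrite groupE; apply: chain_platonic => // [k|k|i j ij].
- by rewrite x0E ler0n.
- by rewrite x0E ltr0n lt0b.
rewrite bangle// oppr_lt0; have := chain_bond Xchain ij.
case: eqP => _; first by move=> /(link_gt0 R).
by move=> /eqP ->; rewrite link2 ltxx.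
Qed.
End ChainDiagrams.

Lemma pivot_ones (R : realType) (t : nat -> R) i :
  (forall j, (0 < j <= i)%N -> t j = 1) -> pivot t i = i.+2%:R / i.+1%:R.
Proof.
elim: i => [_|i IH t1]; first by rewrite divr1.
rewrite [LHS]/= IH => [|j /andP[j0 ji]]; last by rewrite t1// j0 ltnW.
rewrite t1 ?ltnS ?leqnn// -!natr1.
have i0 : 0 <= i%:R :> R := ler0n _ _.
by field; rewrite !gt_eqF//; lra.
Qed.

(** When all links but the last one are simple, the last pivot is
    2 - t ^ 2 (n - 1) / n. *)
Lemma pivot_last (R : realType) (t : nat -> R) n : (2 <= n)%N ->
  (forall j, (0 < j < n.-1)%N -> t j = 1) ->
  t n.-1 ^+ 2 * (n.-1)%:R < 2 * n%:R ->
  forall i, (i < n)%N -> 0 < pivot t i.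
Proof.
move=> n2 t1 tn i ni; have [i1|i1] := eqVneq i n.-1; last first.
  by rewrite pivot_ones ?divr_gt0 ?ltr0n// => j ji; apply: t1; lia.
case: n n2 t1 tn ni i1 => [|[|n]]// _ t1 tn _ -> /=.
rewrite pivot_ones => [|j ji]; last by apply: t1 => /=; lia.
move: tn => /=; have : 0 <= n%:R :> R := ler0n _ _.
rewrite -!natr1; move: (n%:R) (t n.+1) => N T N0 TN.
rewrite subr_gt0 invf_div mulrA ltr_pdivrMr; lra.
Qed.

Section Existence.
Variable R : realType.

Lemma type_A_platonic n : (3 <= n)%N -> gives_platonic R n FamA.
Proof.
move=> n3; have t1 i : (0 < i)%N -> chain_weight R n FamA i = 1.
  by case: i => // i _; rewrite /chain_weight /= eqxx link3.
apply: chain_gives_platonic => // [|i ni|beta bfree bgram].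
- by rewrite /=; lia.
- by rewrite pivot_ones ?divr_gt0 ?ltr0n// => j /andP[j0 _]; apply: t1.
- by apply: (type_A_finite bfree bgram) => i /andP[i0 _]; apply: t1.
Qed.

Lemma type_BC_platonic n X : (3 <= n)%N -> X = FamB \/ X = FamC ->
  gives_platonic R n X.
Proof.
move=> n3 XBC.
have t1 i : (0 < i < n.-1)%N -> chain_weight R n X i = 1.
  case: i => // i ni; rewrite /chain_weight; have i1 : (i.+1 == n.-1) = false by lia.
  by case: XBC => -> /=; rewrite eqxx i1 link3.
have tn : chain_weight R n X n.-1 ^+ 2 = 2.
  rewrite /chain_weight; case: n n3 {t1} => [|[|n]]// _.
  by case: XBC => -> /=; rewrite !eqxx link4.
have Xn : is_diagram X n by case: XBC => -> /=; lia.
apply: chain_gives_platonic => // [|i ni|beta bfree bgram].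
- by case: XBC => ->.
- apply: (pivot_last _ t1) ni; first by lia.
  by rewrite tn ltr_pM2l// ltr_nat; lia.
- by apply: (type_BC_finite bfree bgram) => //; lia.
Qed.

Lemma type_F_platonic : gives_platonic R 4 FamF.
Proof.
apply: chain_gives_platonic => // [i|beta bfree bgram].
  pose t := chain_weight R 4 FamF.
  have t1 : t 1 = 1 by rewrite /t /chain_weight /= link3.
  have t2 : t 2 ^+ 2 = 2 by rewrite /t /chain_weight /= link4.
  have t3 : t 3 = 1 by rewrite /t /chain_weight /= link3.
  have p1 : pivot t 1 = 3 / 2 by rewrite [LHS]/= t1; lra.
  have p2 : pivot t 2 = 2 / 3 by rewrite [LHS]/= -/(pivot t 1) p1 t2; lra.
  have p3 : pivot t 3 = 1 / 2 by rewrite [LHS]/= -/(pivot t 2) p2 t3; lra.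
  by case: i => [|[|[|[|i]]]]// _; rewrite -/t ?p1 ?p2 ?p3 ?divr_gt0.
apply: (@computed_finite _ _ _ _ bfree bgram 2 0 2 _ _ (list_roots 2 0 2 4)).
- by rewrite mul0r addr0 /chain_weight /= link4.
- by move=> [|[|[|[|i]]]]// _ _; rewrite /chain_weight /= link3.
- by vm_compute.
Qed.

(** Here t is the golden ratio, and positivity of the last pivot amounts to
    t + 1 < 2 n / (n - 1), which for n = 4 reads t < 5 / 3. *)
Lemma type_H_platonic n : n = 3 \/ n = 4 -> gives_platonic R n FamH.
Proof.
move=> n34; have n3 : (3 <= n)%N by lia.
have t1 i : (0 < i < n.-1)%N -> chain_weight R n FamH i = 1.
  case: i => // i ni; have i1 : (i.+1 == n.-1) = false by lia.
  by rewrite /chain_weight /= eqxx i1 link3.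
have tn : chain_weight R n FamH n.-1 = link R 5.
  by rewrite /chain_weight; case: n34 => ->.
have l5 := link5 R; have l0 := @link_gt0 R 5 isT.
apply: chain_gives_platonic => // [|i ni|beta bfree bgram].
- by rewrite /=; lia.
- apply: (pivot_last _ t1) ni; first by lia.
  have l53 : link R 5 < 5 / 3.
    rewrite ltNge; apply/negP => l53; have := ler_wpM2r (ltW l0) l53.
    by rewrite -expr2 l5; lra.
  by rewrite tn l5; case: n34 => -> /=; lra.
- apply: (@computed_finite _ _ _ _ bfree bgram 1 1 n.-1 _ _
    (list_roots 1 1 n.-1 n)).
  + by rewrite tn l5; ring.
  + by move=> i i0 i1; apply: t1; lia.
  + by case: n34 => ->; vm_compute.
Qed.
End Existence.

Theorem corollary2p2 (R : realType) (n : nat) (X : diagram_family) :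
  (3 <= n)%N -> is_diagram X n ->
  (gives_platonic R n X <->
   (X = FamA \/ X = FamB \/ X = FamC \/
    (X = FamF /\ n = 4%N) \/
    (X = FamH /\ n = 3%N) \/
    (X = FamH /\ n = 4%N))).
Proof.
move=> n3 Xn; split; last first.
  case=> [->|[XB|[XC|[[-> ->]|[[-> n34]|[-> n34]]]]]].
  - exact: type_A_platonic.
  - by apply: type_BC_platonic => //; left.
  - by apply: type_BC_platonic => //; right.
  - exact: type_F_platonic.
  - by apply: type_H_platonic; left.
  - by apply: type_H_platonic; right.
move=> plat.
have nofork : ~ ((X = FamD /\ (4 <= n)%N) \/ (X = FamE /\ (6 <= n)%N)).
  by move=> /(fork_gives_no_platonic (R := R) n3 Xn) /(_ plat).
case: X Xn {plat} nofork => /= Xn nofork.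
- by left.
- by right; left.
- by right; right; left.
- by case: nofork; left.
- by case: nofork; right; split=> //; case/andP: Xn.
- by right; right; right; left; split=> //; apply/eqP.
- by move: n3; rewrite (eqP Xn).
- do 4 right; have [n4|n3'] : n = 4%N \/ n = 3%N by lia.
    by right.
  by left.
Qed.
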